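(* Let $(\mathcal{A},P,\alpha)$ be a semigroup dynamical system and let $K:\Lambda_{(\mathcal{A},P,\alpha)}\to\mathcal{B}(\mathcal{H})$ be a kernel system on a Hilbert space $\mathcal{H}$ that is unital, Hermitian, Toeplitz, linear and positive. Then there exist a Hilbert space $\mathcal{K}\supseteq\mathcal{H}$, an isometric representation $V:P\to\mathcal{B}(\mathcal{K})$ and a $*$-homomorphism $\pi:\mathcal{A}\to\mathcal{B}(\mathcal{K})$ satisfying \[V(p)\pi(a)=\pi(\alpha_p(a))V(p)\qquad (p\in P,\ a\in\mathcal{A})\] such that \[K(p,a,q)=P_{\mathcal{H}}V(p)^*\pi(a)V(q)\big|_{\mathcal{H}}\qquad\text{for all }(p,a,q)\in\Lambda_{(\mathcal{A},P,\alpha)}.\] Moreover, $(\pi,V)$ can be taken to be minimal in the sense that \[\mathcal{K}=\overline{\operatorname{span}}\{\pi(a)V(p)h: p\in P,\ a\in\mathcal{A}\alpha_p(1),\ h\in\mathcal{H}\},\] and such a minimal dilation $(\pi,V)$ is unique up to unitary equivalence.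
   Context: $P$ is a left-cancellative semigroup with identity $e$, $\mathcal{A}$ is a unital $\mathrm{C}^*$-algebra, and $\alpha$ is a $P$-action: each $\alpha_p$ ($p\in P$) is an injective (not necessarily unital) $*$-endomorphism of $\mathcal{A}$, $\alpha_p\circ\alpha_q=\alpha_{pq}$, $\alpha_e=\mathrm{id}$. The triple $(\mathcal{A},P,\alpha)$ is called a semigroup dynamical system. (No right LCM assumption is made.) An isometric representation of $P$ is a unital semigroup homomorphism into $\mathcal{B}(\mathcal{K})$ whose values are isometries. For $p,q\in P$ put $\mathcal{A}_{p,q}=\alpha_p(1)\mathcal{A}\alpha_q(1)$ and $\Lambda_{(\mathcal{A},P,\alpha)}=\{(p,a,q):p,q\in P,\ a\in\mathcal{A}_{p,q}\}$. One has $\alpha_r(\mathcal{A}_{p,q})\subseteq\mathcal{A}_{rp,rq}$. A kernel system on $\mathcal{H}$ is a map $K:\Lambda_{(\mathcal{A},P,\alpha)}\to\mathcal{B}(\mathcal{H})$. It is: unital if $K(e,1,e)=I$; Hermitian if $K(p,a,q)^*=K(q,a^*,p)$; Toeplitz if $K(p,a,q)=K(rp,\alpha_r(a),rq)$ for all $r\in P$; linear if $K(p,a,q)+\lambda K(p,b,q)=K(p,a+\lambda b,q)$ for all $a,b\in\mathcal{A}_{p,q}$, $\lambda\in\mathbb{C}$; positive if for all $p_1,\dots,p_n\in P$ and $a_1,\dots,a_n\in\mathcal{A}$ with $a_i\in\mathcal{A}\alpha_{p_i}(1)$, the operator matrix $[K(p_i,a_i^*a_j,p_j)]_{i,j}$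 is positive (semidefinite) on $\mathcal{H}^n$. Unitary equivalence of two dilations means intertwining by a unitary between the dilation spaces that is the identity on $\mathcal{H}$. *)

(* Defs.v *)
From HB Require Import structures.
From mathcomp Require Import all_boot all_order all_algebra.
From mathcomp Require Import boolp classical_sets functions reals topology.
From mathcomp Require Import interval_inference normedtype sequences.
From mathcomp Require Import complex.
From mathcomp Require Import ring lra.

Set Implicit Arguments.
Unset Strict Implicit.
Unset Printing Implicit Defensive.

Import Order.TTheory GRing.Theory Num.Theory.

Local Open Scope classical_set_scope.
Local Open Scope complex_scope.
Local Open Scope ring_scope.

(* The inner product is linear in its first argument. *)
HB.mixin Record CompleteNormedModule_isHilbert (R : realType) H
    & CompleteNormedModule R[i] H := {
  inner : H -> H -> R[i];
  innerDl : forall x y z, inner (x + y) z = inner x z + inner y z;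
  innerZl : forall a x z, inner (a *: x) z = a * inner x z;
  inner_conj : forall x y, inner x y = (inner y x)^*;
  inner_norm : forall x, inner x x = `|x| ^+ 2
}.

#[short(type="hilbertType")]
HB.structure Definition Hilbert (R : realType) :=
  {H of CompleteNormedModule R[i] H & CompleteNormedModule_isHilbert R H}.

(* Unital associative *-algebras over R[i]; 1 = 0 is allowed. The product is a
   field of this mixin because the MathComp hierarchy has no join of semirings
   with modules above LSemiAlgebra, nor of semirings with norms above
   NumDomain, so that a normed algebra cannot be declared on top of pzRingType
   or algType. *)
HB.mixin Record Lmodule_isStarAlgebra (R : realType) A
    & GRing.Lmodule R[i] A := {
  amul : A -> A -> A;
  aone : A;
  star : A -> A;
  amulA : associative amul;
  amul1 : left_id aone amul;
  mul1a : right_id aone amul;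
  amulDl : left_distributive amul +%R;
  amulDr : right_distributive amul +%R;
  amulZl : forall k x y, amul (k *: x) y = k *: amul x y;
  amulZr : forall k x y, amul x (k *: y) = k *: amul x y;
  starK : involutive star;
  starD : {morph star : x y / x + y};
  starZ : forall k x, star (k *: x) = k^* *: star x;
  starM : forall x y, star (amul x y) = amul (star y) (star x)
}.

#[short(type="starAlgType")]
HB.structure Definition StarAlgebra (R : realType) :=
  {A of GRing.Lmodule R[i] A & Lmodule_isStarAlgebra R A}.

Notation "x ** y" := (amul x y) (at level 40, left associativity) : ring_scope.

HB.mixin Record StarAlgebra_isCStar (R : realType) A
    & StarAlgebra R A & CompleteNormedModule R[i] A := {
  cstar_normM : forall x y : A, `|x ** y| <= `|x| * `|y|;
  cstar_norm : forall x : A, `|star x ** x| = `|x| ^+ 2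
}.

#[short(type="cstarAlgType")]
HB.structure Definition CStarAlgebra (R : realType) :=
  {A of StarAlgebra R A & CompleteNormedModule R[i] A
      & StarAlgebra_isCStar R A}.

Section InnerProduct.
Variables (R : realType) (H : hilbertType R).
Implicit Types x y z : H.

Lemma innerDr x y z : inner x (y + z) = inner x y + inner x z.
Proof.
by rewrite inner_conj innerDl rmorphD /= -!(inner_conj x).
Qed.

Lemma innerZr a x y : inner x (a *: y) = a^* * inner x y.
Proof. by rewrite inner_conj innerZl rmorphM /= -inner_conj. Qed.

Lemma innerNl x y : inner (- x) y = - inner x y.
Proof. by rewrite -scaleN1r innerZl mulN1r. Qed.

Lemma innerBl x y z : inner (x - y) z = inner x z - inner y z.
Proof. by rewrite innerDl innerNl. Qed.

Lemma innerNr x y : inner x (- y) = - inner x y.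
Proof. by rewrite -scaleN1r innerZr rmorphN1 mulN1r. Qed.

Lemma innerBr x y z : inner x (y - z) = inner x y - inner x z.
Proof. by rewrite innerDr innerNr. Qed.

Lemma inner_inj x y : (forall z, inner z x = inner z y) -> x = y.
Proof.
move=> xy; apply/eqP; rewrite -subr_eq0 -normr_eq0 -sqrf_eq0 -inner_norm.
by rewrite innerBr xy subrr.
Qed.

Lemma CauchySchwarz x y : `|inner x y| <= `|x| * `|y|.
Proof.
have [->|y0] := eqVneq y 0.
  by rewrite -(scale0r 0) innerZr rmorph0 mul0r scale0r !normr0 mulr0.
have ny0 : 0 < `|y| by rewrite normr_gt0.
rewrite -(@ler_pXn2r _ 2) ?nnegrE ?mulr_ge0 // exprMn.
have : 0 <= inner (`|y| ^+ 2 *: x - inner x y *: y) (`|y| ^+ 2 *: x - inner x y *: y).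
  by rewrite inner_norm exprn_ge0.
rewrite innerBl !innerBr !innerZl !innerZr !inner_norm.
rewrite (inner_conj y x) (CrealP _); last by rewrite realX // normr_real.
rewrite normCK; set a := inner x y; set b := `|y|; set c := `|x|.
have -> : b ^+ 2 * (b ^+ 2 * c ^+ 2) - b ^+ 2 * (a^* * a) -
  (a * (b ^+ 2 * a^*) - a * (a^* * b ^+ 2)) = b ^+ 2 * (c ^+ 2 * b ^+ 2 - a * a^*).
  by ring.
by rewrite pmulr_rge0 ?exprn_gt0 // subr_ge0.
Qed.

End InnerProduct.

Section Riesz.
Variables (R : realType) (H : hilbertType R).
Implicit Types x y z : H.

Let ip x y : R := complex.Re (inner x y).
Let nm x : R := complex.Re `|x|.

Let nmE x : `|x| = (nm x)%:C.
Proof. by rewrite RRe_real // normr_real. Qed.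

Let nm_ge0 x : 0 <= nm x.
Proof. by rewrite -ler0c -nmE. Qed.

Let ipxx x : ip x x = nm x ^+ 2.
Proof. by rewrite /ip inner_norm nmE -rmorphXn. Qed.

Let ipC x y : ip x y = ip y x.
Proof. by rewrite /ip inner_conj; case: (inner y x). Qed.

Let ipDl x y z : ip (x + y) z = ip x z + ip y z.
Proof. by rewrite /ip innerDl raddfD. Qed.

Let ReZ (t : R) (c : R[i]) : complex.Re (t%:C * c) = t * complex.Re c.
Proof. by case: c => a b /=; rewrite mul0r subr0. Qed.

Let ipZl (t : R) x z : ip (t%:C *: x) z = t * ip x z.
Proof. by rewrite /ip innerZl ReZ. Qed.

Let ipDr x y z : ip x (y + z) = ip x y + ip x z.
Proof. by rewrite ipC ipDl !(ipC x). Qed.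

Let ipZr (t : R) x z : ip x (t%:C *: z) = t * ip x z.
Proof. by rewrite ipC ipZl (ipC x). Qed.

Let nmD x y : nm (x + y) ^+ 2 = nm x ^+ 2 + nm y ^+ 2 + 2 * ip x y.
Proof. by rewrite -!ipxx !ipDl !ipDr (ipC y x); ring. Qed.

Let nmZ (t : R) x : nm (t%:C *: x) ^+ 2 = t ^+ 2 * nm x ^+ 2.
Proof. by rewrite -!ipxx ipZl ipZr; ring. Qed.

Let ip_le x y : `|ip x y| <= nm x * nm y.
Proof.
rewrite -lecR rmorphM /= -!nmE; apply: le_trans (CauchySchwarz x y).
rewrite /ip; case: (inner x y) => a b /=.
by rewrite normc_def /= lecR -sqrtr_sqr ler_wsqrtr // lerDl sqr_ge0.
Qed.

Lemma Riesz (f : H -> R[i]) (M : R) :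
  (forall x y, f (x + y) = f x + f y) -> (forall a x, f (a *: x) = a * f x) ->
  (forall x, `|f x| <= M%:C * `|x|) ->
  exists z, forall x, f x = inner x z.
Proof.
move=> fD fZ fM.
pose q x : R := complex.Re (f x).
have qD x y : q (x + y) = q x + q y by rewrite /q fD raddfD.
have qZ (t : R) x : q (t%:C *: x) = t * q x by rewrite /q fZ ReZ.
have qM x : `|q x| <= M * nm x.
  rewrite -lecR rmorphM /= -!nmE; apply: le_trans (fM x).
  rewrite /q; case: (f x) => a b /=.
  by rewrite normc_def /= lecR -sqrtr_sqr ler_wsqrtr // lerDl sqr_ge0.
pose Phi x : R := nm x ^+ 2 - 2 * q x.
pose S : set R := range Phi.
have lbS : has_inf S.
  split; first by exists (Phi 0); exists 0.
  exists (- M ^+ 2) => _ [x _ <-]; rewrite /Phi.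
  have := qM x; rewrite ler_norml => /andP[_ qx].
  have := sqr_ge0 (nm x - M); nra.
pose m := inf S.
have mP x : m <= Phi x by apply: ge_inf; [case: lbS|exists x].
have appr k : exists x, Phi x < m + k.+1%:R^-1.
  have [|_ [x _ <-] h] := @inf_adherent _ S k.+1%:R^-1 _ lbS.
    by rewrite invr_gt0.
  by exists x.
have [u uP] := choice appr.
have par x y : nm (x - y) ^+ 2 <= 2 * (Phi x - m) + 2 * (Phi y - m).
  have h := mP (2^-1%:C *: (x + y)).
  move: h; rewrite /Phi nmZ qZ qD nmD.
  have -> : x - y = x + (-1)%:C *: y by rewrite rmorphN1 scaleN1r.
  by rewrite nmD nmZ ipZr; lra.
have ucvg : cvg (u @ \oo).
  apply: cauchy_cvg; apply/cauchy_ballP => e e0.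
  have er : e = (complex.Re e)%:C by rewrite RRe_real // gtr0_real.
  have r0 : 0 < complex.Re e by rewrite -ltcR -er.
  pose d := complex.Re e ^+ 2 / 4.
  have d0 : 0 < d by rewrite divr_gt0 // exprn_gt0.
  have small : \forall k \near \oo, k.+1%:R^-1 < d.
    exact: (near_infty_natSinv_lt (PosNum d0)).
  pose A := u @` [set k | k.+1%:R^-1 < d].
  exists (A, A).
    by split => /=; apply: filterS small => k kd; exists k.
  move=> [_ _] [] /= [i id <-] [j jd <-]; rewrite -ball_normE /ball_ /=.
  rewrite er nmE ltcR -(@ltr_pXn2r _ 2) ?nnegrE ?nm_ge0 ?ltW //.
  apply: le_lt_trans (par _ _) _.
  have hi : Phi (u i) - m < d by rewrite ltrBlDl (lt_trans (uP i)) // ltrD2l.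
  have hj : Phi (u j) - m < d by rewrite ltrBlDl (lt_trans (uP j)) // ltrD2l.
  have -> : complex.Re e ^+ 2 = 4 * d by rewrite /d; field.
  by move: (Phi (u i)) (Phi (u j)) hi hj => ? ? ? ?; lra.
pose z := lim (u @ \oo).
have key x (t : R) : 0 <= t ^+ 2 * nm x ^+ 2 + 2 * t * (ip z x - q x).
  rewrite leNgt; apply/negP; set v := (X in X < 0) => v0.
  pose D := 1 + 2 * `|t| * nm x.
  have D0 : 0 < D by rewrite ltr_pwDl // !mulr_ge0.
  pose d := - v / D.
  have d0 : 0 < d by rewrite divr_gt0 // oppr_gt0.
  have dD : d * D = - v by rewrite divfK // gt_eqF.
  have dc0 : 0 < d%:C :> R[i] by rewrite (ltcR 0).
  near \oo => k.
  have k1 : k.+1%:R^-1 < d.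
    by near: k; exact: (near_infty_natSinv_lt (PosNum d0)).
  have k2 : nm (z - u k) < d.
    rewrite -ltcR -nmE; near: k.
    by move/cvgrPdist_lt : (ucvg); apply.
  pose w := ip z x - ip (u k) x.
  have wE : w = ip (z - u k) x.
    have -> : z - u k = z + (-1)%:C *: u k by rewrite rmorphN1 scaleN1r.
    by rewrite ipDl ipZl mulN1r.
  have wd : - (t * w) <= `|t| * (d * nm x).
    apply: le_trans (ler_norm _) _; rewrite normrN normrM ler_wpM2l // wE.
    by apply: le_trans (ip_le _ _) _; rewrite ler_wpM2r // ltW.
  have h1 : Phi (u k) < m + d by rewrite (lt_trans (uP k)) // ltrD2l.
  have := mP (u k + t%:C *: x).
  have -> : Phi (u k + t%:C *: x) = Phi (u k) + v - 2 * (t * w).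
    by rewrite /Phi nmD nmZ ipZr qD qZ /v /w; ring.
  move: dD h1 wd; rewrite /D; move: (Phi _) (t * w) => p tw dD h1 wd h2.
  have e1 : `|t| * (d * nm x) * 2 + d = - v by rewrite -dD; ring.
  lra.
have re x : q x = ip x z.
  rewrite ipC; set b := ip z x; set a := nm x ^+ 2.
  have a0 : 0 <= a by rewrite exprn_ge0.
  have a1 : a + 1 != 0 by rewrite gt_eqF // ltr_wpDl.
  have := key x ((q x - b) / (a + 1)); rewrite -/a -/b.
  have -> : ((q x - b) / (a + 1)) ^+ 2 * a + 2 * ((q x - b) / (a + 1)) * (b - q x) =
     - (((q x - b) / (a + 1)) ^+ 2 * (a + 2)) by field.
  rewrite oppr_ge0 pmulr_lle0 ?ltr_wpDl // => h.
  apply/eqP; rewrite -subr_eq0; move: h.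
  rewrite le_eqVlt ltNge sqr_ge0 orbF sqrf_eq0 mulf_eq0 invr_eq0 (negbTE a1) orbF.
  by [].
exists z => x; apply/eqP; rewrite eq_complex; apply/andP; split.
  by rewrite -/(q x) re.
have := re ((- 'i) *: x); rewrite /q /ip fZ innerZl.
by case: (f x) => a b; case: (inner x z) => c d /=; simpc => ->.
Unshelve. all: by end_near. Qed.
End Riesz.

Definition bounded_linear (R : realType) (H K : hilbertType R) : {pred H -> K} :=
  fun T => `[< linear T /\
               exists M : R, forall x, `|T x| <= M%:C * `|x| >].

Record bop (R : realType) (H K : hilbertType R) := BOp {
  bop_fun :> H -> K;
  bop_funP : bop_fun \in @bounded_linear R H K
}.

Notation "''B' ( H , K )" := (bop H K) (format "''B' ( H ,  K )") : type_scope.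
Notation "''B' ( H )" := (bop H H) (format "''B' ( H )") : type_scope.

HB.instance Definition _ (R : realType) (H K : hilbertType R) :=
  [isSub for @bop_fun R H K].
HB.instance Definition _ (R : realType) (H K : hilbertType R) :=
  [Choice of 'B(H, K) by <:].

Section BoundedOperators.
Variables (R : realType) (H K : hilbertType R).

Fact bounded_linear_submod : submod_closed (@bounded_linear R H K).
Proof.
split=> [|a S T /asboolP[linS [M SM]] /asboolP[linT [N TN]]]; apply/asboolP.
  split=> [k x y|]; first by rewrite scaler0 addr0.
  by exists 0 => x; rewrite normr0 mul0r.
split=> [k x y|].
  rewrite /= -[(a *: S + T) _]/(a *: S _ + T _) linS linT.
  rewrite -[(a *: S + T) x]/(a *: S x + T x) -[(a *: S + T) y]/(a *: S y + T y).
  rewrite !scalerDr !scalerA (mulrC a) addrACA; congr (_ + _).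
pose r := complex.Re `|a|.
have ra : r%:C = `|a| by rewrite /r RRe_real // normr_real.
exists (r * M + N) => x; rewrite rmorphD rmorphM mulrDl /= ra -mulrA.
apply: le_trans (ler_normD _ _) _; rewrite lerD // normrZ ler_wpM2l //.
Qed.
HB.instance Definition _ := GRing.isSubmodClosed.Build R[i] (H -> K)
  (@bounded_linear R H K) bounded_linear_submod.
HB.instance Definition _ := [SubChoice_isSubLmodule of 'B(H, K) by <:].

Implicit Types S T : 'B(H, K).

Fact bop_linear T : linear T.
Proof. by have /asboolP[] := bop_funP T. Qed.
HB.instance Definition _ T := GRing.isLinear.Build R[i] H K *:%R T (bop_linear T).

Lemma bop_bounded T : exists M : R, forall x, `|T x| <= M%:C * `|x|.
Proof. by have /asboolP[] := bop_funP T. Qed.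

Lemma bopP S T : S =1 T <-> S = T.
Proof. by split=> [/funext ST|->//]; apply: val_inj. Qed.

Lemma bopD S T x : (S + T) x = S x + T x. Proof. by []. Qed.
Lemma bopN T x : (- T) x = - T x. Proof. by []. Qed.
Lemma bopZ a T x : (a *: T) x = a *: T x. Proof. by []. Qed.
Lemma bop0 x : (0 : 'B(H, K)) x = 0. Proof. by []. Qed.

End BoundedOperators.

Section Composition.
Variable R : realType.

Fact bid_bounded (H : hilbertType R) : idfun \in @bounded_linear R H H.
Proof.
by apply/asboolP; split=> [//|]; exists 1 => x; rewrite mul1r.
Qed.
Definition bid (H : hilbertType R) : 'B(H) := BOp (bid_bounded H).

Fact bcomp_bounded (H K L : hilbertType R) (S : 'B(K, L)) (T : 'B(H, K)) :
  S \o T \in @bounded_linear R H L.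
Proof.
apply/asboolP; split=> [k x y /=|]; first by rewrite !linearP.
have [M SM] := bop_bounded S; have [N TN] := bop_bounded T.
exists (`|M| * N) => x /=; rewrite rmorphM /= -mulrA.
apply: le_trans (SM _) _; apply: (@le_trans _ _ (`|M|%:C * `|T x|)).
  by rewrite ler_wpM2r // lecR ler_norm.
by rewrite ler_wpM2l // ler0c.
Qed.
Definition bcomp (H K L : hilbertType R) (S : 'B(K, L)) (T : 'B(H, K)) :
  'B(H, L) := BOp (bcomp_bounded S T).
End Composition.

Notation "S \b T" := (bcomp S T) (at level 50, left associativity) : ring_scope.

(* The default value 0 below is never used, by adjointP. *)
Section Adjoint.
Variables (R : realType) (H K : hilbertType R).

Definition adjoint (T : 'B(H, K)) : 'B(K, H) :=
  xget 0 [set S : 'B(K, H) | forall x y, inner (T x) y = inner x (S y)].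

Lemma adjointP (T : 'B(H, K)) x y : inner (T x) y = inner x (adjoint T y).
Proof.
move: x y; rewrite /adjoint; case: xgetP => [S _ //|] noS; exfalso.
have [M TM] := bop_bounded T.
have TM' x : `|T x| <= `|M|%:C * `|x|.
  by apply: le_trans (TM x) _; rewrite ler_wpM2r // lecR ler_norm.
have M0 : 0 <= `|M|%:C :> R[i] by rewrite ler0c.
have ex y : exists z, forall x, inner (T x) y = inner x z.
  pose r := complex.Re `|y|.
  have ry : r%:C = `|y| by rewrite /r RRe_real // normr_real.
  apply: (@Riesz _ _ (fun x => inner (T x) y) (`|M| * r)).
  - by move=> u v; rewrite linearD innerDl.
  - by move=> a u; rewrite linearZ innerZl.
  move=> x; apply: le_trans (CauchySchwarz _ _) _.
  by rewrite rmorphM /= ry mulrAC ler_wpM2r.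
have [S SP] := choice ex.
have Sb : S \in @bounded_linear R K H.
  apply/asboolP; split=> [k x y|].
    by apply: inner_inj => z; rewrite innerDr innerZr -!SP innerDr innerZr.
  exists `|M| => y; have [->|Sy0] := eqVneq (S y) 0.
    by rewrite normr0 mulr_ge0.
  have ny0 : 0 < `|S y| by rewrite normr_gt0.
  rewrite -(ler_pM2l ny0) -expr2 -inner_norm -SP.
  have -> : inner (T (S y)) y = `|inner (T (S y)) y|.
    by rewrite ger0_norm // SP inner_norm exprn_ge0.
  apply: le_trans (CauchySchwarz _ _) _.
  by rewrite mulrA (mulrC `|S y|) ler_wpM2r.
exact: (noS (BOp Sb) (fun x y => SP y x)).
Qed.

Lemma adjoint_unique (T : 'B(H, K)) (S : 'B(K, H)) :
  (forall x y, inner (T x) y = inner x (S y)) -> S = adjoint T.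
Proof.
move=> TS; apply/bopP => y; apply: inner_inj => x.
by rewrite -TS adjointP.
Qed.

End Adjoint.

Section StarAlgebraOfOperators.
Variables (R : realType) (H : hilbertType R).
Implicit Types (S T U : 'B(H)) (k : R[i]).

Let mulA : associative (@bcomp R H H H).
Proof. by move=> S T U; apply/bopP. Qed.
Let mul1 : left_id (bid H) (@bcomp R H H H).
Proof. by move=> T; apply/bopP. Qed.
Let mulr1' : right_id (bid H) (@bcomp R H H H).
Proof. by move=> T; apply/bopP. Qed.
Let mulDl : left_distributive (@bcomp R H H H) +%R.
Proof. by move=> S T U; apply/bopP. Qed.
Let mulDr : right_distributive (@bcomp R H H H) +%R.
Proof. by move=> S T U; apply/bopP => x; exact: (linearD S). Qed.
Let mulZl k S T : (k *: S) \b T = k *: (S \b T).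
Proof. by apply/bopP. Qed.
Let mulZr k S T : S \b (k *: T) = k *: (S \b T).
Proof. by apply/bopP => x; exact: (linearZ_LR S). Qed.
Let adjK : involutive (@adjoint R H H).
Proof.
move=> T; apply/esym/adjoint_unique => x y.
by rewrite inner_conj -adjointP -inner_conj.
Qed.
Let adjD : {morph @adjoint R H H : S T / S + T}.
Proof.
move=> S T; apply/esym/adjoint_unique => x y.
by rewrite !bopD innerDl innerDr !adjointP.
Qed.
Let adjZ k T : adjoint (k *: T) = k^* *: adjoint T.
Proof.
apply/esym/adjoint_unique => x y.
by rewrite !bopZ innerZl innerZr conjCK adjointP.
Qed.
Let adjM S T : adjoint (S \b T) = adjoint T \b adjoint S.
Proof.
by apply/esym/adjoint_unique => x y; rewrite /= !adjointP.
Qed.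

HB.instance Definition _ := Lmodule_isStarAlgebra.Build R 'B(H)
  mulA mul1 mulr1' mulDl mulDr mulZl mulZr adjK adjD adjZ adjM.

End StarAlgebraOfOperators.

Definition is_star_hom (R : realType) (A B : starAlgType R) (f : A -> B) :
    Prop :=
  [/\ linear f, {morph f : x y / x ** y} & {morph f : x / star x}].

Definition is_isometry (R : realType) (H K : hilbertType R) (T : 'B(H, K)) :
    Prop :=
  forall x, `|T x| = `|x|.

Definition is_unitary (R : realType) (H K : hilbertType R) (U : 'B(H, K)) :
    Prop :=
  adjoint U \b U = bid H /\ U \b adjoint U = bid K.

Lemma isometry_inner (R : realType) (H K : hilbertType R) (J : 'B(H, K)) x y :
  is_isometry J -> inner (J x) (J y) = inner x y.
Proof.
move=> isoJ; pose B u v := inner (J u) (J v) - inner u v.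
have B0 u : B u u = 0 by rewrite /B !inner_norm isoJ subrr.
have BD u v : B u v + B v u = 0.
  have : B (u + v) (u + v) = B u u + B u v + (B v u + B v v).
    by rewrite /B linearD !innerDl !innerDr; ring.
  by rewrite !B0 add0r addr0.
have BZ u v k : B (k *: u) v = k * B u v.
  by rewrite /B linearZ !innerZl mulrBr.
have BZr u v k : B u (k *: v) = k^* * B u v.
  by rewrite /B linearZ !innerZr mulrBr.
have := BD x ('i *: y); rewrite BZ BZr conjCi mulNr addrC -mulrBr.
move/eqP; rewrite mulf_eq0 (negbTE (neq0Ci _)) /= subr_eq0 => /eqP E.
have := BD x y; rewrite E -mulr2n => /eqP; rewrite mulrn_eq0 /= /B subr_eq0.
by move/eqP.
Qed.

(* An inclusion H <= K of Hilbert spaces is rendered by an isometric operator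
   J : 'B(H, K); the orthogonal projection P_H of K onto H is then adjoint J:
   J (adjoint J x) lies in the image of J and x - J (adjoint J x) is orthogonal
   to it. *)
Lemma adjoint_isometry_proj (R : realType) (H K : hilbertType R)
    (J : 'B(H, K)) (x : K) (h : H) :
  is_isometry J -> inner (x - J (adjoint J x)) (J h) = 0.
Proof.
move=> isoJ; rewrite innerBl isometry_inner // inner_conj adjointP.
by rewrite -inner_conj subrr.
Qed.

Definition lin_span (R : realType) (V : lmodType R[i]) (S : set V) : set V :=
  [set v | exists (n : nat) (c : 'I_n -> R[i]) (x : 'I_n -> V),
     (forall i, S (x i)) /\ v = \sum_(i < n) c i *: x i].

Definition left_cancellative (P : monoidType) : Prop :=
  forall p q r : P, (p * q = p * r)%g -> q = r.

Record is_action (R : realType) (P : monoidType) (A : cstarAlgType R)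
    (alpha : P -> A -> A) : Prop := {
  action_star_hom : forall p, is_star_hom (alpha p);
  action_inj : forall p, injective (alpha p);
  action_comp : forall p q a, alpha p (alpha q a) = alpha (p * q)%g a;
  action_id : forall a, alpha 1%g a = a
}.

Section KernelSystem.
Variables (R : realType) (P : monoidType) (A : cstarAlgType R).
Variable alpha : P -> A -> A.

Definition corner (p q : P) : set A :=
  [set alpha p aone ** x ** alpha q aone | x in setT].

Definition right_corner (p : P) : set A :=
  [set x ** alpha p aone | x in setT].

Variable H : hilbertType R.

(* A kernel system is a function on the triples (p, a, q) with a in corner p q;
   it is represented by a function on all triples, whose values at the other
   triples are never referred to. *)
Variable K : P -> A -> P -> 'B(H).

Definition kernel_unital : Prop := K 1%g aone 1%g = bid H.

Definition kernel_hermitian : Prop :=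
  forall p a q, corner p q a -> adjoint (K p a q) = K q (star a) p.

Definition kernel_toeplitz : Prop :=
  forall p a q, corner p q a ->
  forall r, K p a q = K (r * p)%g (alpha r a) (r * q)%g.

Definition kernel_linear : Prop :=
  forall p q a b, corner p q a -> corner p q b ->
  forall lambda : R[i],
    K p a q + lambda *: K p b q = K p (a + lambda *: b) q.

(* Positivity of the operator matrix [T i j] on H ^ n. In the order of R[i],
   0 <= z includes that z is real. *)
Definition opmx_positive n (T : 'I_n -> 'I_n -> 'B(H)) : Prop :=
  forall h : 'I_n -> H,
    0 <= \sum_(i < n) inner (\sum_(j < n) T i j (h j)) (h i).

Definition kernel_positive : Prop :=
  forall n (p : 'I_n -> P) (a : 'I_n -> A),
    (forall i, right_corner (p i) (a i)) ->
    opmx_positive (fun i j => K (p i) (star (a i) ** a j) (p j)).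

Definition isometric_rep (L : hilbertType R) (V : P -> 'B(L)) : Prop :=
  [/\ V 1%g = bid L, (forall p q, V (p * q)%g = V p \b V q)
    & forall p, is_isometry (V p)].

Record is_dilation (L : hilbertType R) (J : 'B(H, L)) (V : P -> 'B(L))
    (pi : A -> 'B(L)) : Prop := {
  dilation_incl : is_isometry J;
  dilation_rep : isometric_rep V;
  dilation_hom : is_star_hom pi;
  dilation_cov : forall p a, V p \b pi a = pi (alpha p a) \b V p;
  dilation_eq : forall p a q, corner p q a ->
    K p a q = adjoint J \b adjoint (V p) \b pi a \b V q \b J
}.

Definition is_minimal (L : hilbertType R) (J : 'B(H, L)) (V : P -> 'B(L))
    (pi : A -> 'B(L)) : Prop :=
  closure (lin_span [set x | exists p a h,
    right_corner p a /\ x = pi a (V p (J h))]) = setT.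

Definition unitarily_equivalent
    (L1 : hilbertType R) (J1 : 'B(H, L1)) (V1 : P -> 'B(L1))
    (pi1 : A -> 'B(L1))
    (L2 : hilbertType R) (J2 : 'B(H, L2)) (V2 : P -> 'B(L2))
    (pi2 : A -> 'B(L2)) : Prop :=
  exists U : 'B(L1, L2),
    [/\ is_unitary U, U \b J1 = J2,
        (forall a, U \b pi1 a = pi2 a \b U)
      & (forall p, U \b V1 p = V2 p \b U)].

End KernelSystem.

(* Main.v *)
Require Import Defs.
From HB Require Import structures.
From mathcomp Require Import all_boot all_order all_algebra.
From mathcomp Require Import boolp classical_sets functions reals topology.
From mathcomp Require Import interval_inference normedtype sequences complex.
From mathcomp Require Import ring lra.

Set Implicit Arguments.
Unset Strict Implicit.
Unset Printing Implicit Defensive.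

Import Order.TTheory GRing.Theory Num.Theory.
Import numFieldNormedType.Exports.

Local Open Scope classical_set_scope.
Local Open Scope complex_scope.
Local Open Scope ring_scope.

(** Every minimal dilation is spanned by the vectors pi(a alpha_p(1)) V(p) h, and
their inner products are dictated by K:
  < pi(b e_q) V(q) h', pi(a e_p) V(p) h >
     = < K(p, (a e_p)^* (b e_q), q) h', h >,     e_p = alpha_p(1).
The proof reads this formula as a positive definite kernel on the set of
generators (p, a, h).

Uniqueness: two families that are total in their Hilbert spaces and have the same
inner products correspond under a unitary ([total_unitary]); pi, V and J act on
the generators by formulas in which the dilation space does not occur, so this
unitary intertwines them.

Existence: positivity and hermitianness of K make the formula a positive definite
kernel, hence the Gram kernel of a total family phi in some Hilbert space
([kernel_feature_space], the Kolmogorov-Moore-Aronszajn theorem). The operators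
are then forced: pi(b) phi(p, a, h) = phi(p, b a, h),
V(r) phi(p, a, h) = phi(r p, alpha_r(a), h) and J h = phi(1, 1, h). They extend
from the total family to the whole space by [total_extension] and
[total_isometry] as soon as they are bounded on linear combinations. For V this is
the Toeplitz condition, which makes V(r) isometric. For pi one has to see that
M^2 |x|^2 - |pi(b) x|^2 >= 0 for M > |b|; this number is M^2 |pi(y) x|^2 for a
self-adjoint square root y of 1 - b^*b / M^2. Since |b^*b / M^2| < 1, such a root
exists in any C*-algebra by a contraction argument ([sqrt_one_sub]), without
spectral theory.

The Hilbert space of a positive definite kernel is realized as the space of the
functions f on the generators whose energy 2 Re f(s) - |s|^2 is bounded above as s
ranges over the finite formal combinations s of generators; the supremum of the
energy is the square of the norm. This is the antidual of the pre-Hilbert space of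
formal combinations, which is complete without adding limits or dividing by null
vectors. Completing the square gives
|f - s|^2 = |f|^2 - (2 Re f(s) - |s|^2), so a combination of nearly maximal energy
is close to f: combinations are dense, and the polarized norm, which is linear
against combinations, is an inner product. *)

(** * Real parts and real epsilons *)

Section RealParts.
Variable R : realType.
Implicit Types a b : R[i].

Lemma cRe_conj a : complex.Re a^* = complex.Re a.
Proof. by case: a. Qed.
Lemma cIm_conj a : complex.Im a^* = - complex.Im a.
Proof. by case: a. Qed.
Lemma cReM a b : complex.Re (a * b) =
  complex.Re a * complex.Re b - complex.Im a * complex.Im b.
Proof. by case: a; case: b. Qed.
Lemma cReD a b : complex.Re (a + b) = complex.Re a + complex.Re b.
Proof. exact: raddfD. Qed.
Lemma cReN a : complex.Re (- a) = - complex.Re a.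
Proof. exact: raddfN. Qed.

Lemma realcM (x y : R) : (x * y)%:C = x%:C * y%:C.
Proof. exact: rmorphM. Qed.
Lemma realcD (x y : R) : (x + y)%:C = x%:C + y%:C.
Proof. exact: rmorphD. Qed.
Lemma realcV (x : R) : x^-1%:C = x%:C^-1.
Proof. exact: fmorphV. Qed.

End RealParts.

Section Metric.
Variables (R : realType) (V : completeNormedModType R[i]).

Lemma Re_normK (W : normedZmodType R[i]) (x : W) : (complex.Re `|x|)%:C = `|x|.
Proof. by rewrite RRe_real // normr_real. Qed.

Lemma gtr0_Re (e : R[i]) : 0 < e -> e = (complex.Re e)%:C /\ 0 < complex.Re e.
Proof.
move=> e0; have er : e = (complex.Re e)%:C by rewrite RRe_real // gtr0_real.
by split=> //; rewrite -ltcR -er.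
Qed.

(** The constant C absorbs the factors that accumulate in an estimate, so that
    no epsilon has to be divided in advance. *)
Lemma le_eps (x : R) (C : R) : 0 <= C ->
  (forall e, 0 < e -> x <= C * e) -> x <= 0.
Proof.
move=> C0 xe; apply/ler_addgt0Pr => e e0; rewrite add0r.
apply: le_trans (xe (e / (C + 1)) _) _; first by rewrite divr_gt0 // ltr_wpDl.
by rewrite mulrCA ler_piMr ?(ltW e0) // ler_pdivrMr ?ltr_wpDl // mul1r lerDl.
Qed.

Lemma norm_eps0 (W : normedZmodType R[i]) (x : W) (C : R) : 0 <= C ->
  (forall e : R, 0 < e -> `|x| <= (C * e)%:C) -> x = 0.
Proof.
move=> C0 xe; apply/eqP; rewrite -normr_le0.
rewrite -Re_normK lecR; apply: (le_eps C0) => e e0.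
by rewrite -lecR Re_normK xe.
Qed.

Lemma cauchy_seq_limit (u : nat -> V) :
  (forall e : R, 0 < e ->
     exists N, forall m n, (N <= m)%N -> (N <= n)%N -> `|u m - u n| < e%:C) ->
  exists l, forall e : R, 0 < e ->
    exists N, forall n, (N <= n)%N -> `|l - u n| < e%:C.
Proof.
move=> uC; have ucvg : cvg (u @ \oo).
  apply: cauchy_cvg; apply/cauchy_ballP => e e0.
  have [er r0] := gtr0_Re e0; have [N NP] := uC _ r0.
  exists (u @` [set k | (N <= k)%N], u @` [set k | (N <= k)%N]).
    by split; exists N => // k /= Nk; exists k.
  move=> [_ _] [] /= [i Ni <-] [j Nj <-].
  by rewrite -ball_normE /ball_ /= er NP.
exists (lim (u @ \oo)) => e e0.
have e0' : 0 < e%:C :> R[i] by rewrite ltcR.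
by have /cvgrPdist_lt /(_ _ e0')[N _ NP] := ucvg; exists N => n /NP.
Qed.

Lemma natSinv_lt (e : R) : 0 < e ->
  exists N, forall n, (N <= n)%N -> n.+1%:R^-1 < e.
Proof.
move=> e0; have [N _ NP] := near_infty_natSinv_lt (PosNum e0).
by exists N => n /NP.
Qed.

End Metric.

(** * Square roots in a C*-algebra *)

Section SquareRoot.
Variables (R : realType) (A : cstarAlgType R).
Implicit Types x y z : A.

(** The C*-identity gives |y|^2 = |y^* y| <= |y^*| |y|, and y^** = y. *)
Lemma norm_star x : `|star x| = `|x|.
Proof.
have le y : `|y| <= `|star y|.
  have [->|y0] := eqVneq y 0; first by rewrite normr0.
  have ny0 : 0 < `|y| by rewrite normr_gt0.
  by rewrite -(ler_pM2r ny0) -expr2 -cstar_norm cstar_normM.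
by apply/eqP; rewrite eq_le le /= -{2}(starK x) le.
Qed.

Lemma amulBl x y z : (x - y) ** z = x ** z - y ** z.
Proof. by rewrite amulDl -scaleN1r amulZl scaleN1r. Qed.

Lemma amulBr x y z : z ** (x - y) = z ** x - z ** y.
Proof. by rewrite amulDr -scaleN1r amulZr scaleN1r. Qed.

Lemma star1 : star (aone : A) = aone.
Proof. by rewrite -[LHS]mul1a -{2}(starK aone) -starM mul1a starK. Qed.

(** With y = 1 - z the equation y^2 = 1 - x reads z = (x + z^2) / 2. For |x| < 1
    the right-hand side maps the ball of radius t = |x| into itself, because
    (t + t^2) / 2 <= t, and is a contraction of ratio t there. Its fixed point is
    self-adjoint by uniqueness, since z^* solves the same equation. *)
Lemma sqrt_one_sub x : star x = x -> `|x| < 1 ->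
  exists y, star y = y /\ y ** y = aone - x.
Proof.
move=> xx x1; set t := `|x|; have t0 : 0 <= t := normr_ge0 x.
pose g z := 2^-1 *: (x + z ** z).
have g_ball z : `|z| <= t -> `|g z| <= t.
  move=> zt; rewrite /g normrZ ger0_norm ?invr_ge0 // ler_pdivrMl //.
  rewrite mulr2n mulrDl mul1r; apply: le_trans (ler_normD _ _) _.
  rewrite lerD2l; apply: le_trans (cstar_normM _ _) _.
  apply: le_trans (ler_pM _ _ zt zt) _ => //.
  by rewrite ler_piMr // ltW.
have g_lip z z' : `|z| <= t -> `|z'| <= t -> `|g z - g z'| <= t * `|z - z'|.
  move=> zt zt'; rewrite /g -scalerBr normrZ ger0_norm ?invr_ge0 //.
  rewrite ler_pdivrMl // opprD addrACA subrr add0r.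
  (* A is not commutative, so z^2 - z'^2 need not be (z - z') (z + z') *)
  have -> : z ** z - z' ** z' = z ** (z - z') + (z - z') ** z'.
    by rewrite amulBr amulBl addrA subrK.
  apply: le_trans (ler_normD _ _) _; rewrite mulr_natl mulr2n lerD //.
    by apply: le_trans (cstar_normM _ _) _; rewrite ler_wpM2r.
  by apply: le_trans (cstar_normM _ _) _; rewrite mulrC ler_wpM2r.
have fix_uniq z z' : `|z| <= t -> `|z'| <= t -> g z = z -> g z' = z' -> z = z'.
  move=> zt zt' gz gz'; have := g_lip _ _ zt zt'; rewrite gz gz' => h.
  apply/eqP; rewrite -subr_eq0 -normr_le0; move: h.
  rewrite -subr_ge0 -{2}[`|z - z'|]mul1r -mulrBl nmulr_rge0 ?subr_lt0 //.
pose u n := iter n g 0.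
have u_ball n : `|u n| <= t by elim: n => [|n] /=; [rewrite normr0|exact: g_ball].
pose r := complex.Re t; have tr : t = r%:C := esym (Re_normK x).
have r0 : 0 <= r by rewrite -ler0c -tr.
have r1 : r < 1 by rewrite -ltcR -tr.
have u_dist n m : `|u (n + m)%N - u n| <= (r ^+ n)%:C.
  elim: n => [|n IH].
    by rewrite add0n subr0 expr0 (le_trans (u_ball m)) // ltW.
  rewrite addSn /=; apply: le_trans (g_lip _ _ (u_ball _) (u_ball _)) _.
  by rewrite exprS rmorphM /= -tr ler_wpM2l.
have rn (e : R) : 0 < e -> exists N, forall n, (N <= n)%N -> r ^+ n < e.
  move=> e0; have r1' : `|r| < 1 by rewrite ger0_norm.
  have /cvgrPdist_lt /(_ _ e0)[N _ NP] := cvg_expr r1'.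
  exists N => n /NP /=.
  by rewrite sub0r normrN ger0_norm // exprn_ge0.
have [|l lP] := @cauchy_seq_limit _ _ u.
  move=> e e0; have [N NP] := rn _ e0; exists N => m n.
  wlog mn : m n / (m <= n)%N => [W Nm Nn|Nm _].
    by case/orP: (leq_total m n) => h; [|rewrite distrC]; apply: W.
  rewrite distrC -(subnKC mn) (le_lt_trans (u_dist _ _)) // ltcR.
  exact: NP.
have l_ball : `|l| <= t.
  rewrite tr -Re_normK lecR -subr_le0; apply: (@le_eps _ _ 1) => // e e0.
  have [N NP] := lP _ e0; rewrite mul1r lerBlDr -lecR rmorphD /= Re_normK -tr.
  rewrite -[l](subrK (u N)); apply: le_trans (ler_normD _ _) _.
  by rewrite lerD ?u_ball // ltW // NP.
have gl : g l = l.
  apply/eqP; rewrite -subr_eq0; apply/eqP.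
  apply: (@norm_eps0 _ _ _ 2) => // e e0; have [N NP] := lP _ e0.
  have -> : g l - l = (g l - g (u N)) + (u N.+1 - l) by rewrite addrA subrK.
  apply: le_trans (ler_normD _ _) _; rewrite mulr_natl mulr2n rmorphD /=.
  apply: lerD; last first.
    by rewrite distrC; apply: ltW; exact: (NP N.+1).
  apply: le_trans (g_lip _ _ l_ball (u_ball _)) _.
  by apply: le_trans (ltW (NP N _)) => //; rewrite ler_piMl // ltW.
have sl : star l = l.
  apply: fix_uniq => //; first by rewrite norm_star.
  by rewrite -{2}gl /g starZ starD starM xx fmorphV rmorph_nat.
exists (aone - l); split.
  by rewrite starD -scaleN1r starZ rmorphN1 !scaleN1r sl star1.
rewrite amulBl !amulBr !amul1 !mul1a.
have : 2 *: g l = x + l ** l by rewrite /g scalerA divff ?scale1r ?pnatr_eq0.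
rewrite gl scaler_nat mulr2n => h.
have -> : x = l + l - l ** l by rewrite h addrK.
by rewrite !opprB !opprD !addrA; congr (_ - _); rewrite addrAC.
Qed.

End SquareRoot.

(** * Positive definite kernels and formal combinations *)

Section Kernels.
Variables (R : realType) (T : Type).

(* A sequence of pairs (c, t) stands for the formal combination of the t with
   coefficients c; concatenation is its sum, and no quotient is taken. *)
Notation comb := (seq (R[i] * T)).

Definition kform (k : T -> T -> R[i]) (s s' : comb) : R[i] :=
  \sum_(u <- s) \sum_(v <- s') u.1 * v.1^* * k u.2 v.2.

Record pd_kernel := PDKernel {
  kval :> T -> T -> R[i];
  kval_herm : forall s t, kval s t = (kval t s)^*;
  kval_pos : forall s : comb, 0 <= kform kval s s
}.

Variable k : pd_kernel.
Implicit Types (s : comb) (f g : T -> R[i]) (a : R[i]).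

(** If f t stands for the inner product of f with t, then this is the inner
    product of f with the combination s; it is conjugate-linear in s. *)
Definition ev f s : R[i] := \sum_(u <- s) u.1^* * f u.2.
Definition cscale a s : comb := [seq (a * u.1, u.2) | u <- s].
Definition ksec s : T -> R[i] := fun t => \sum_(u <- s) u.1 * k u.2 t.
Definition qf s : R := complex.Re (kform k s s).
(** Equal to |f|^2 - |f - s|^2 when f lies in the completion of the combinations:
    its supremum over s is then |f|^2. *)
Definition energy f s : R := 2 * complex.Re (ev f s) - qf s.

Lemma ev_cat f s s' : ev f (s ++ s') = ev f s + ev f s'.
Proof. by rewrite /ev big_cat. Qed.

Lemma ev_cscale f a s : ev f (cscale a s) = a^* * ev f s.
Proof.
rewrite /ev big_map mulr_sumr; apply: eq_bigr => u _ /=.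
by rewrite rmorphM mulrA.
Qed.

Lemma evD f g s : ev (f + g) s = ev f s + ev g s.
Proof. by rewrite /ev -big_split; apply: eq_bigr => u _; exact: mulrDr. Qed.

Lemma evZ a f s : ev (a *: f) s = a * ev f s.
Proof.
by rewrite /ev mulr_sumr; apply: eq_bigr => u _; exact: mulrCA.
Qed.

Lemma evN f s : ev (- f) s = - ev f s.
Proof. by rewrite -scaleN1r evZ mulN1r. Qed.

Lemma ev_ksec s s' : ev (ksec s) s' = kform k s s'.
Proof.
rewrite /ev /kform exchange_big /=; apply: eq_bigr => v _.
rewrite mulr_sumr; apply: eq_bigr => u _; ring.
Qed.

Lemma kform_herm s s' : kform k s s' = (kform k s' s)^*.
Proof.
rewrite /kform exchange_big /= rmorph_sum; apply: eq_bigr => v _.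
rewrite rmorph_sum; apply: eq_bigr => u _ /=.
by rewrite !rmorphM /= conjCK -kval_herm; ring.
Qed.

Lemma kform_catr s1 s2 s : kform k s (s1 ++ s2) = kform k s s1 + kform k s s2.
Proof. by rewrite -!ev_ksec ev_cat. Qed.

Lemma kform_catl s1 s2 s : kform k (s1 ++ s2) s = kform k s1 s + kform k s2 s.
Proof. by rewrite /kform big_cat. Qed.

Lemma kform_scaler a s s' : kform k s (cscale a s') = a^* * kform k s s'.
Proof. by rewrite -!ev_ksec ev_cscale. Qed.

Lemma kform_scalel a s s' : kform k (cscale a s) s' = a * kform k s s'.
Proof.
by rewrite kform_herm kform_scaler rmorphM /= conjCK -kform_herm.
Qed.

Lemma kform_qf s : kform k s s = (qf s)%:C.
Proof. by rewrite RRe_real // ger0_real // kval_pos. Qed.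

Lemma qf_ge0 s : 0 <= qf s.
Proof. by rewrite -ler0c -kform_qf kval_pos. Qed.

Lemma qf_cat s s' : qf (s ++ s') = qf s + qf s' + 2 * complex.Re (kform k s s').
Proof.
rewrite /qf kform_catl !kform_catr !cReD (kform_herm s' s) cRe_conj; ring.
Qed.

Lemma qf_cscale a s :
  qf (cscale a s) = (complex.Re a ^+ 2 + complex.Im a ^+ 2) * qf s.
Proof.
rewrite /qf kform_scalel kform_scaler mulrA cReM kform_qf /= mulr0 subr0.
by rewrite cReM cRe_conj cIm_conj; ring.
Qed.

Lemma energy_nil f : energy f [::] = 0.
Proof. by rewrite /energy /qf /ev /kform !big_nil mulr0 subr0. Qed.

(** Maximizing the energy of f over the combinations that extend s amounts to
    maximizing the energy of f - s: this translation is behind the density of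
    combinations. *)
Lemma energy_cat f s s' :
  energy f (s ++ s') = energy f s + energy (f - ksec s) s'.
Proof.
rewrite /energy ev_cat qf_cat evD evN ev_ksec !cReD cReN; ring.
Qed.

(** The difference of the two sides is |s - s'|^2. *)
Lemma energy_ksec_le s s' : energy (ksec s) s' <= qf s.
Proof.
have := qf_ge0 (s ++ cscale (-1) s').
rewrite qf_cat qf_cscale kform_scaler /energy ev_ksec cReM cRe_conj cIm_conj.
move: (kform _ _ _) => z /=; rewrite oppr0; nra.
Qed.

End Kernels.

(** * Functions of finite energy *)

Section Energy.
Variables (R : realType) (T : Type) (k : pd_kernel R T).
Implicit Types (s : seq (R[i] * T)) (f g : T -> R[i]) (a : R[i]).

Definition finite_energy : {pred T -> R[i]} :=
  fun f => `[< exists M, forall s, energy k f s <= M >].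

Definition energy_sup f : R := sup (range (energy k f)).

Lemma finite_energyP f :
  reflect (exists M, forall s, energy k f s <= M) (f \in finite_energy).
Proof. exact: asboolP. Qed.

Lemma energy_le_sup f s : f \in finite_energy -> energy k f s <= energy_sup f.
Proof.
move=> /finite_energyP[M fM]; apply: ub_le_sup; last by exists s.
by exists M => _ [s' _ <-].
Qed.

Lemma energy_sup_le f M : (forall s, energy k f s <= M) -> energy_sup f <= M.
Proof.
move=> fM; apply: ge_sup; first by exists (energy k f [::]); exists [::].
by move=> _ [s' _ <-].
Qed.

Lemma energy_sup_ge0 f : f \in finite_energy -> 0 <= energy_sup f.
Proof. by move=> /(energy_le_sup [::]); rewrite energy_nil. Qed.

Definition fnorm f : R := Num.sqrt (energy_sup f).

Lemma fnorm_ge0 f : 0 <= fnorm f. Proof. exact: sqrtr_ge0. Qed.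

Lemma fnorm_sqr f : f \in finite_energy -> fnorm f ^+ 2 = energy_sup f.
Proof. by move=> fF; rewrite sqr_sqrtr // energy_sup_ge0. Qed.

(** Cauchy-Schwarz: the energy of f along the real multiples r s is the quadratic
    2 r x - r^2 q, whose maximum x^2 / q is at most the supremum. *)
Lemma Re_ev_le f s : f \in finite_energy ->
  `|complex.Re (ev f s)| <= fnorm f * Num.sqrt (qf k s).
Proof.
move=> fF; set x := complex.Re _.
have q0 := qf_ge0 k s; set q := qf k s in q0 *.
have N0 := energy_sup_ge0 fF.
have key r : 2 * r * x - r ^+ 2 * q <= energy_sup f.
  have := energy_le_sup (cscale r%:C s) fF.
  rewrite /energy ev_cscale qf_cscale cReM cRe_conj cIm_conj /= -/x -/q.
  by rewrite expr0n /= addr0 oppr0 mul0r subr0 mulrA.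
suff h : x ^+ 2 <= energy_sup f * q.
  by rewrite -sqrtrM // -sqrtr_sqr ler_wsqrtr.
have [q_eq0|q_neq0] := eqVneq q 0.
  have [->|x0] := eqVneq x 0; first by rewrite expr0n mulr_ge0.
  (* for q = 0 the quadratic is linear in r, and unbounded unless x = 0 *)
  have := key ((energy_sup f + 1) / x); rewrite q_eq0 mulr0 subr0.
  by rewrite -mulrA divfK //; lra.
have := key (x / q); rewrite -(ler_pM2r (_ : 0 < q)) ?lt_def ?q_neq0 //.
by congr (_ <= _); field.
Qed.

(** Replacing s by its multiple by ev f s rotates ev f s onto the real axis. *)
Lemma ev_le f s : f \in finite_energy ->
  `|ev f s| <= (fnorm f * Num.sqrt (qf k s))%:C.
Proof.
move=> fF; have [->|e0] := eqVneq (ev f s) 0.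
  by rewrite normr0 ler0c mulr_ge0 ?fnorm_ge0 ?sqrtr_ge0.
set z := ev f s; pose r := complex.Re `|z|.
have zr : `|z| = r%:C by rewrite Re_normK.
have r0 : 0 < r by rewrite -ltcR -zr normr_gt0.
have z2 : complex.Re z ^+ 2 + complex.Im z ^+ 2 = r ^+ 2.
  by have := add_Re2_Im2 z; rewrite zr -rmorphXn => -[].
have := Re_ev_le (cscale z s) fF; rewrite ev_cscale qf_cscale -/z z2.
rewrite cReM cRe_conj cIm_conj mulNr opprK -!expr2 z2 ger0_norm ?sqr_ge0 //.
rewrite sqrtrM ?sqr_ge0 // sqrtr_sqr ger0_norm ?(ltW r0) // expr2.
by rewrite mulrCA ler_pM2l // zr lecR.
Qed.

(** Converse of [Re_ev_le], by 2 M b - b^2 <= M^2: the norm is also the norm of f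
    as a functional on combinations, which makes the triangle inequality and
    homogeneity immediate. *)
Lemma finite_energy_bound f M : 0 <= M ->
  (forall s, `|complex.Re (ev f s)| <= M * Num.sqrt (qf k s)) ->
  f \in finite_energy /\ fnorm f <= M.
Proof.
move=> M0 fM; have le s : energy k f s <= M ^+ 2.
  have := fM s; rewrite ler_norml => /andP[_ h].
  rewrite /energy -[qf k s]sqr_sqrtr ?qf_ge0 //.
  have := sqr_ge0 (M - Num.sqrt (qf k s)); nra.
split; first by apply/finite_energyP; exists (M ^+ 2).
rewrite -[M]ger0_norm // -sqrtr_sqr ler_wsqrtr //; exact: energy_sup_le.
Qed.

Lemma fnormD f g : f \in finite_energy -> g \in finite_energy ->
  f + g \in finite_energy /\ fnorm (f + g) <= fnorm f + fnorm g.
Proof.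
move=> fF gF; apply: finite_energy_bound => [|s].
  by rewrite addr_ge0 ?fnorm_ge0.
rewrite evD cReD mulrDl; apply: le_trans (ler_normD _ _) _.
by rewrite lerD ?Re_ev_le.
Qed.

Lemma fnormZ_le a f : f \in finite_energy ->
  a *: f \in finite_energy /\ fnorm (a *: f) <= complex.Re `|a| * fnorm f.
Proof.
move=> fF; apply: finite_energy_bound => [|s].
  by rewrite mulr_ge0 ?fnorm_ge0 // -ler0c Re_normK.
rewrite -mulrA -lecR; apply: le_trans (normc_ge_Re _) _.
rewrite evZ normrM realcM Re_normK.
by rewrite ler_wpM2l // ev_le.
Qed.

Lemma ksec_finite_energy s : ksec k s \in finite_energy.
Proof. by apply/finite_energyP; exists (qf k s); exact: energy_ksec_le. Qed.

Lemma energy_supB_le f s : f \in finite_energy ->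
  energy_sup (f - ksec k s) <= energy_sup f - energy k f s.
Proof.
move=> fF; apply: energy_sup_le => s'; have := energy_le_sup (s ++ s') fF.
by rewrite energy_cat; lra.
Qed.

Fact finite_energy_submod : submod_closed finite_energy.
Proof.
split=> [|a f g fF gF].
  apply/finite_energyP; exists 0 => s; have := energy_ksec_le k [::] s.
  rewrite /ksec /qf /kform big_nil /=.
  suff -> : (fun t => \sum_(u <- [::]) u.1 * k u.2 t) = 0 by [].
  by apply/funext => t; rewrite big_nil.
by have [+ _] := fnormZ_le a fF; move=> /fnormD /(_ gF)[].
Qed.

End Energy.

Record rkhs (R : realType) (T : Type) (k : pd_kernel R T) := RKHS {
  rkhs_fun :> T -> R[i];
  rkhs_funP : rkhs_fun \in finite_energy k
}.

HB.instance Definition _ (R : realType) (T : Type) (k : pd_kernel R T) :=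
  [isSub for @rkhs_fun R T k].
HB.instance Definition _ (R : realType) (T : Type) (k : pd_kernel R T) :=
  [Choice of rkhs k by <:].
HB.instance Definition _ (R : realType) (T : Type) (k : pd_kernel R T) :=
  GRing.isSubmodClosed.Build R[i] (T -> R[i]) (finite_energy k)
    (finite_energy_submod k).
HB.instance Definition _ (R : realType) (T : Type) (k : pd_kernel R T) :=
  [SubChoice_isSubLmodule of rkhs k by <:].

Section RKHS.
Variables (R : realType) (T : Type) (k : pd_kernel R T).
Implicit Types (f g h : rkhs k) (s : seq (R[i] * T)) (a : R[i]).

Lemma rkhsP f g : f =1 g -> f = g.
Proof. by move=> /funext fg; apply: val_inj. Qed.

Definition rnorm f : R := fnorm k f.

Lemma rnorm_ge0 f : 0 <= rnorm f. Proof. exact: fnorm_ge0. Qed.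

Lemma ev1 (f : T -> R[i]) t : ev f [:: (1, t)] = f t.
Proof. by rewrite /ev big_seq1 /= rmorph1 mul1r. Qed.

Lemma rnormD f g : rnorm (f + g) <= rnorm f + rnorm g.
Proof. by have [] := fnormD (rkhs_funP f) (rkhs_funP g). Qed.

(** The inequality for all scalars, applied to a^-1, gives the equality. *)
Lemma rnormZ a f : rnorm (a *: f) = complex.Re `|a| * rnorm f.
Proof.
have le b g : rnorm (b *: g) <= complex.Re `|b| * rnorm g.
  by have [] := fnormZ_le b (rkhs_funP g).
apply/eqP; rewrite eq_le le andTb; have [->|a0] := eqVneq a 0.
  by rewrite normr0 mul0r rnorm_ge0.
have r0 : 0 < complex.Re `|a| by rewrite -ltcR Re_normK normr_gt0.
rewrite -ler_pdivlMl //; have := le a^-1 (a *: f).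
rewrite scalerA mulVf // scale1r => /le_trans -> //.
by rewrite ler_wpM2r ?rnorm_ge0 // -lecR realcV !Re_normK normfV.
Qed.

(** Point evaluations are bounded, so functions of norm zero vanish: the function
    space needs no quotient by null vectors. *)
Lemma rnorm_eq0 f : rnorm f = 0 -> f = 0.
Proof.
move=> f0; apply: rkhsP => t; apply/eqP; rewrite -normr_le0 -[X in `|X|]ev1.
by have := ev_le [:: (1, t)] (rkhs_funP f); rewrite -/(rnorm f) f0 mul0r.
Qed.

Let cnorm f : R[i] := (rnorm f)%:C.

Fact cnormD f g : cnorm (f + g) <= cnorm f + cnorm g.
Proof. by rewrite -rmorphD lecR rnormD. Qed.

Fact cnormZ a f : cnorm (a *: f) = `|a| * cnorm f.
Proof. by rewrite /cnorm rnormZ realcM Re_normK. Qed.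

Fact cnorm_eq0 f : cnorm f = 0 -> f = 0.
Proof. by move=> [] /rnorm_eq0. Qed.

HB.instance Definition _ :=
  @Lmodule_isNormed.Build R[i] (rkhs k) cnorm cnormD cnormZ cnorm_eq0.

Lemma rkhs_normE f : `|f| = (rnorm f)%:C. Proof. by []. Qed.

End RKHS.

(** * The polarized inner product *)

Section RKHSInner.
Variables (R : realType) (T : Type) (k : pd_kernel R T).
Implicit Types (f g h : rkhs k) (s : seq (R[i] * T)) (a : R[i]).

Definition rsec s : rkhs k := RKHS (ksec_finite_energy k s).

Lemma rnormN f : rnorm (- f) = rnorm f.
Proof. by rewrite -scaleN1r rnormZ normrN normr1 mul1r. Qed.

Lemma rnormB_rsec_le f s :
  rnorm (f - rsec s) ^+ 2 <= rnorm f ^+ 2 - energy k f s.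
Proof.
have := energy_supB_le s (rkhs_funP f).
by rewrite -!fnorm_sqr //; [exact: rkhs_funP|exact: (rkhs_funP (f - rsec s))].
Qed.

(** A combination whose energy nearly attains the supremum is close to f. *)
Lemma rsec_dense f (e : R) : 0 < e -> exists s, rnorm (f - rsec s) < e.
Proof.
move=> e0; have e2 : 0 < e ^+ 2 by rewrite exprn_gt0.
have hs : has_sup (range (energy k f)).
  split; first by exists (energy k f [::]); exists [::].
  exists (energy_sup k f) => _ [s _ <-]; exact: energy_le_sup (rkhs_funP f).
have [_ [s _ <-] h] := sup_adherent e2 hs; exists s.
rewrite -(@ltr_pXn2r _ 2) ?nnegrE ?rnorm_ge0 ?(ltW e0) //.
apply: le_lt_trans (rnormB_rsec_le f s) _.
move: h; rewrite -/(energy_sup k f) -fnorm_sqr ?rkhs_funP // -/(rnorm f); lra.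
Qed.

Lemma rsecN s : rsec (cscale (-1) s) = - rsec s.
Proof.
apply: rkhsP => t; rewrite /= /ksec big_map.
apply: etrans (_ : - \sum_(u <- s) u.1 * k u.2 t = _); last by [].
by rewrite -sumrN; apply: eq_bigr => u _; rewrite /= mulN1r mulNr.
Qed.

Lemma ev_cscaleN (f : T -> R[i]) s : ev f (cscale (-1) s) = - ev f s.
Proof. by rewrite ev_cscale rmorphN1 mulN1r. Qed.

Lemma qf_cscaleN s : qf k (cscale (-1) s) = qf k s.
Proof. by rewrite qf_cscale /= oppr0 expr0n addr0 sqrrN expr1n mul1r. Qed.

(** The reverse inequality comes from [rnormB_rsec_le] for f - s and -s. *)
Lemma rnormB_rsec f s :
  rnorm (f - rsec s) ^+ 2 = rnorm f ^+ 2 - energy k f s.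
Proof.
apply/eqP; rewrite eq_le rnormB_rsec_le /=.
have := rnormB_rsec_le (f - rsec s) (cscale (-1) s).
rewrite rsecN opprK subrK.
suff -> : energy k (f - rsec s) (cscale (-1) s) = - energy k f s by lra.
have -> : energy k (f - rsec s) (cscale (-1) s) =
  energy k (rkhs_fun f - ksec k s) (cscale (-1) s) by [].
rewrite /energy ev_cscaleN qf_cscaleN evD evN ev_ksec kform_qf.
by rewrite !(cReD, cReN) /=; ring.
Qed.

(** Polarization formula for the real part of the inner product. *)
Definition polar f g : R := (rnorm (f + g) ^+ 2 - rnorm (f - g) ^+ 2) / 4.

Lemma polarC f g : polar f g = polar g f.
Proof. by rewrite /polar (addrC f) -(rnormN (f - g)) opprB. Qed.

Lemma rnormD_rsec f s :
  rnorm (f + rsec s) ^+ 2 = rnorm f ^+ 2 + 2 * complex.Re (ev f s) + qf k s.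
Proof.
have := rnormB_rsec f (cscale (-1) s).
rewrite rsecN opprK => ->; rewrite /energy ev_cscaleN qf_cscaleN cReN; ring.
Qed.

Lemma polar_rsec f s : polar f (rsec s) = complex.Re (ev f s).
Proof.
rewrite /polar rnormD_rsec rnormB_rsec /energy.
by move: (rnorm f) (complex.Re _) (qf k s) => x y z; field.
Qed.

Lemma rnorm_sqr_dist f g : rnorm (f - g) <= 1 ->
  `|rnorm f ^+ 2 - rnorm g ^+ 2| <= rnorm (f - g) * (2 * rnorm f + 1).
Proof.
have := rnormD (f - g) g; rewrite subrK.
have := rnormD (g - f) f; rewrite subrK -(rnormN (g - f)) opprB.
have := rnorm_ge0 f; have := rnorm_ge0 g; have := rnorm_ge0 (f - g).
move: (rnorm f) (rnorm g) (rnorm _) => x y z *.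
by rewrite ler_norml; apply/andP; split; nra.
Qed.

(** Continuity of [polar f] at g, with a constant that does not depend on the
    approximating vector. *)
Lemma polar_approx f g : exists2 C, 0 <= C &
  forall h, rnorm (g - h) <= 1 -> `|polar f g - polar f h| <= C * rnorm (g - h).
Proof.
exists (((2 * rnorm (f + g) + 1) + (2 * rnorm (f - g) + 1)) / 4).
  by rewrite divr_ge0 // !addr_ge0 ?mulr_ge0 ?rnorm_ge0.
move=> h gh.
have e1 : (f + g) - (f + h) = g - h by rewrite opprD addrACA subrr add0r.
have e2 : (f - g) - (f - h) = - (g - h).
  by rewrite [- (f - h)]opprD opprK addrACA subrr add0r opprB addrC.
have := @rnorm_sqr_dist (f + g) (f + h); rewrite e1 => /(_ gh).
have := @rnorm_sqr_dist (f - g) (f - h); rewrite e2 rnormN => /(_ gh).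
rewrite /polar; move: (rnorm (f + g)) (rnorm (f - g)) => x y.
move: (rnorm (f + h)) (rnorm (f - h)) (rnorm (g - h)) => z w d.
rewrite !ler_norml => /andP[? ?] /andP[? ?]; apply/andP; split; lra.
Qed.

(** Linearity is plain when g is a combination, by [polar_rsec], and combinations
    are dense. *)
Lemma polar_linear (t : R) f1 f2 g :
  polar (t%:C *: f1 + f2) g = t * polar f1 g + polar f2 g.
Proof.
have [C1 C10 P1] := polar_approx f1 g.
have [C2 C20 P2] := polar_approx f2 g.
have [C3 C30 P3] := polar_approx (t%:C *: f1 + f2) g.
apply/eqP; rewrite -subr_eq0 -normr_le0.
apply: (@le_eps _ _ (C3 + (`|t| * C1 + C2))) => [|e e0].
  by rewrite !addr_ge0 ?mulr_ge0.
have [s] : exists s, rnorm (g - rsec s) < Num.min e 1.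
  by apply: rsec_dense; rewrite lt_min e0 ltr01.
rewrite lt_min => /andP[/ltW se /ltW s1].
move: (P1 _ s1) (P2 _ s1) (P3 _ s1); rewrite !polar_rsec.
have -> : complex.Re (ev (t%:C *: f1 + f2) s) =
    t * complex.Re (ev f1 s) + complex.Re (ev f2 s).
  have -> : ev (t%:C *: f1 + f2) s =
    ev (t%:C *: (f1 : T -> R[i]) + (f2 : T -> R[i])) s by [].
  by rewrite evD evZ cReD cReM /= mul0r subr0.
move: (rnorm (g - rsec s)) (complex.Re (ev f1 s)) (complex.Re (ev f2 s)) se.
move: (polar (t%:C *: f1 + f2) g) (polar f1 g) (polar f2 g).
move=> p3 p1 p2 d x1 x2 se h1 h2 h3.
have -> : p3 - (t * p1 + p2) =
    (p3 - (t * x1 + x2)) - (t * (p1 - x1) + (p2 - x2)).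
  by ring.
apply: (@le_trans _ _ ((C3 + (`|t| * C1 + C2)) * d)); last first.
  by rewrite ler_wpM2l // !addr_ge0 ?mulr_ge0.
apply: le_trans (ler_normB _ _) _; rewrite !mulrDl lerD //.
apply: le_trans (ler_normD _ _) _; rewrite lerD // normrM -mulrA.
by rewrite ler_wpM2l.
Qed.

(** Im <f, g> = Re <f, i g> for an inner product that is conjugate-linear in its
    second argument. *)
Definition rinner f g : R[i] := polar f g +i* polar f ('i *: g).

Lemma rnorm_iZ f : rnorm ('i *: f) = rnorm f.
Proof. by rewrite rnormZ normc_def /= expr0n add0r expr1n sqrtr1 mul1r. Qed.

Lemma polar_i f g : polar ('i *: f) ('i *: g) = polar f g.
Proof. by rewrite /polar -scalerDr -scalerBr !rnorm_iZ. Qed.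

Lemma polarN f g : polar f (- g) = - polar f g.
Proof. by rewrite /polar opprK; lra. Qed.

Lemma polar_il f g : polar ('i *: f) g = - polar f ('i *: g).
Proof.
by rewrite -polar_i scalerA -expr2 sqr_i scaleN1r polarC polarN polarC.
Qed.

Fact rinnerDl f g h : rinner (f + g) h = rinner f h + rinner g h.
Proof.
by rewrite /rinner -{1 2}(scale1r f) !(polar_linear 1) !mul1r; simpc.
Qed.

Fact rinnerZl a f g : rinner (a *: f) g = a * rinner f g.
Proof.
have p0 h : polar 0 h = 0 by rewrite /polar add0r sub0r rnormN subrr mul0r.
have pR (t : R) f' h : polar (t%:C *: f') h = t * polar f' h.
  by rewrite -[t%:C *: f']addr0 polar_linear p0 addr0.
have aE f' : a *: f' = (complex.Re a)%:C *: f' + (complex.Im a)%:C *: ('i *: f').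
  by rewrite scalerA -scalerDl mulrC -complexE.
rewrite /rinner aE !polar_linear !pR !polar_il scalerA -expr2 sqr_i scaleN1r.
rewrite polarN.
by case: a {aE} => x y /=; simpc; congr (_ +i* _); ring.
Qed.

Fact rinner_conj f g : rinner f g = (rinner g f)^*.
Proof.
rewrite /rinner polarC; simpc; congr (_ +i* _).
by rewrite polarC polar_il.
Qed.

Fact rinner_norm f : rinner f f = `|f| ^+ 2.
Proof.
have n2 : rnorm (f + f) = 2 * rnorm f.
  by rewrite -mulr2n -scaler_nat rnormZ ger0_norm.
have n0 : rnorm (0 : rkhs k) = 0.
  by rewrite -(scale0r (0 : rkhs k)) rnormZ normr0 mul0r.
have p0 : polar f ('i *: f) = 0 by have := polar_il f f; rewrite polarC; lra.
rewrite rkhs_normE -rmorphXn /rinner p0; congr (_ +i* _).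
by rewrite /polar subrr n0 n2; move: (rnorm f) => x; field.
Qed.

End RKHSInner.

(** * Completeness *)

Lemma complex_complete (R : realType) (F : set_system R[i]^o) :
  ProperFilter F -> cauchy F -> cvg F.
Proof.
move=> FF /cauchy_ballP FC.
have part (p : R[i] -> R) : (forall z w, p (z - w) = p z - p w) ->
    (forall z, `|p z|%:C <= `|z|) -> cvg (p @ F).
  move=> pB pn; apply: R_complete; apply/cauchy_ballP => e e0.
  have e0' : 0 < e%:C :> R[i] by rewrite ltcR.
  have [[A B] /= [FA FB] AB] := FC _ e0'.
  exists (p @` A, p @` B) => /=.
    split; first by apply: filterS FA => z Az; exists z.
    by apply: filterS FB => z Bz; exists z.
  move=> [_ _] [] /= [z Az <-] [w Bw <-].
  have := AB (z, w) (conj Az Bw); rewrite /= -!ball_normE /ball_ /= => h.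
  by rewrite -pB -ltcR (le_lt_trans (pn _)).
have cR : cvg (@complex.Re R @ F).
  by apply: part => [z w|z]; [exact: raddfB|exact: normc_ge_Re].
have cI : cvg (@complex.Im R @ F).
  apply: part => [z w|z]; first exact: raddfB.
  by rewrite normc_def lecR -sqrtr_sqr ler_wsqrtr // lerDr sqr_ge0.
apply/cvg_ex; exists (lim (@complex.Re R @ F) +i* lim (@complex.Im R @ F)).
apply/cvgrPdist_lt => e /gtr0_Re[-> e0].
have e2 : 0 < complex.Re e / 2 by rewrite divr_gt0.
move/cvgrPdist_lt : cR => /(_ _ e2) cR; move/cvgrPdist_lt : cI => /(_ _ e2) cI.
have dec (a b : R) (w : R[i]) : (a +i* b) - w =
    (a - complex.Re w)%:C + 'i * (b - complex.Im w)%:C.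
  by case: w => x y /=; simpc.
near=> z; rewrite dec.
apply: le_lt_trans (ler_normD _ _) _.
rewrite normrM normCi mul1r !normc_def /= !expr0n /= !addr0 !sqrtr_sqr.
rewrite -rmorphD ltcR.
rewrite [X in _ < X](splitr (complex.Re e)) ltrD //; near: z; [exact: cR|exact: cI].
Unshelve. all: by end_near. Qed.

Section RKHSComplete.
Variables (R : realType) (T : Type) (k : pd_kernel R T).

(** Values at points converge because point evaluations are bounded; the
    pointwise limit is a limit in norm because the estimates
    |ev (f - g) s| <= e |s|, uniform in s, pass to pointwise limits. *)
Fact rkhs_complete (F : set_system (rkhs k)) :
  ProperFilter F -> cauchy F -> cvg F.
Proof.
move=> FF /cauchy_ballP FC.
have ev_dist (f g : rkhs k) s :
    `|ev f s - ev g s| <= `|f - g| * (Num.sqrt (qf k s))%:C.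
  have := ev_le s (rkhs_funP (f - g)); rewrite realcM; congr (_ <= _).
  have -> : ev (f - g) s = ev ((f : T -> R[i]) - (g : T -> R[i])) s by [].
  by rewrite evD evN.
have pt t : cvg ((fun f : rkhs k => f t : R[i]^o) @ F).
  apply: complex_complete; apply/cauchy_ballP => e e0.
  pose q := Num.sqrt (qf k [:: (1, t)]).
  have q0 : 0 < (q + 1)%:C :> R[i] by rewrite ltcR ltr_wpDl ?sqrtr_ge0.
  have [[A B] /= [FA FB] AB] := FC _ (divr_gt0 e0 q0).
  exists ((fun f : rkhs k => f t : R[i]^o) @` A,
          (fun f : rkhs k => f t : R[i]^o) @` B) => /=.
    split; first by apply: filterS FA => z Az; exists z.
    by apply: filterS FB => z Bz; exists z.
  move=> [_ _] [] /= [f Af <-] [g Bg <-].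
  have := AB (f, g) (conj Af Bg); rewrite /= -!ball_normE /ball_ /=.
  rewrite ltr_pdivlMr // => h; apply: le_lt_trans h; rewrite -(ev1 f) -(ev1 g).
  apply: le_trans (ev_dist _ _ _) _; rewrite ler_wpM2l // lecR lerDl //.
pose l t : R[i] := lim ((fun f : rkhs k => f t : R[i]^o) @ F).
have evl s (d : R) : 0 < d ->
    \forall g \near F, `|ev l s - ev (g : rkhs k) s| < d%:C.
  move=> d0; have d0' : 0 < d%:C :> R[i] by rewrite ltcR.
  suff : (fun g : rkhs k => ev g s : R[i]^o) @ F --> (ev l s : R[i]^o).
    by move/cvgrPdist_lt; apply.
  elim: s => [|u s IH]; rewrite /ev.
    rewrite big_nil; under eq_fun do rewrite big_nil; exact: cvg_cst.
  rewrite big_cons; under eq_fun do rewrite big_cons.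
  apply: cvgD; last exact: IH.
  by apply: cvgMr; exact: pt.
have key (e : R) : 0 < e -> \forall g \near F,
    forall s, `|ev l s - ev (g : rkhs k) s| <= (e * Num.sqrt (qf k s))%:C.
  move=> e0; have e0' : 0 < e%:C :> R[i] by rewrite ltcR.
  have [[A B] /= [FA FB] AB] := FC _ e0'.
  apply: filterS FA => g Ag s.
  rewrite -[`|_|]Re_normK lecR; apply/ler_addgt0Pr => d d0.
  have [g' [Bg' lg']] := filter_ex (filterI FB (evl s _ d0)).
  rewrite -lecR Re_normK -[ev l s](subrK (ev g' s)) -addrA addrC rmorphD /=.
  apply: le_trans (ler_normD _ _) _; rewrite lerD //; last exact: ltW.
  apply: le_trans (ev_dist _ _ _) _; rewrite realcM ler_wpM2r ?ler0c ?sqrtr_ge0 //.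
  have := AB (g, g') (conj Ag Bg'); rewrite /= -ball_normE /ball_ /= distrC.
  exact: ltW.
have bound (e : R) (g : rkhs k) : 0 < e ->
    (forall s, `|ev l s - ev g s| <= (e * Num.sqrt (qf k s))%:C) ->
    (l - (g : T -> R[i])) \in finite_energy k /\
    fnorm k (l - (g : T -> R[i])) <= e.
  move=> e0 h; apply: finite_energy_bound => [|s]; first exact: ltW.
  by rewrite -lecR evD evN; apply: le_trans (normc_ge_Re _) (h s).
have lF : l \in finite_energy k.
  have [g gP] := filter_ex (key 1 ltr01).
  have [h _] := bound 1 g ltr01 gP.
  by have [] := fnormD h (rkhs_funP g); rewrite subrK.
apply/cvg_ex; exists (RKHS lF); apply/cvgrPdist_le => e /gtr0_Re[-> e0].
apply: filterS (key _ e0) => g gP.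
by rewrite rkhs_normE lecR; have [] := bound _ g e0 gP.
Qed.

HB.instance Definition _ := Uniform_isComplete.Build (rkhs k) rkhs_complete.
HB.instance Definition _ := CompleteNormedModule_isHilbert.Build R (rkhs k)
  (@rinnerDl R T k) (@rinnerZl R T k) (@rinner_conj R T k) (@rinner_norm R T k).

End RKHSComplete.

(** * Total families in Hilbert spaces *)

Lemma inner_adjointl (R : realType) (H1 H2 : hilbertType R) (S : 'B(H1, H2))
    x y :
  inner (adjoint S x) y = inner x (S y).
Proof. by rewrite inner_conj -adjointP -inner_conj. Qed.

Section TotalFamilies.
Variables (R : realType) (T : Type).

Definition lcomb (L : hilbertType R) (phi : T -> L) (s : seq (R[i] * T)) : L :=
  \sum_(u <- s) u.1 *: phi u.2.

Definition total_family (L : hilbertType R) (phi : T -> L) : Prop :=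
  forall (x : L) (e : R), 0 < e -> exists s, `|x - lcomb phi s| < e%:C.

Lemma lcomb1 (L : hilbertType R) (phi : T -> L) t : lcomb phi [:: (1, t)] = phi t.
Proof. by rewrite /lcomb big_seq1 scale1r. Qed.

Lemma lcomb_cat (L : hilbertType R) (phi : T -> L) s s' :
  lcomb phi (s ++ s') = lcomb phi s + lcomb phi s'.
Proof. by rewrite /lcomb big_cat. Qed.

Lemma lcomb_cscale (L : hilbertType R) (phi : T -> L) a s :
  lcomb phi (cscale a s) = a *: lcomb phi s.
Proof.
by rewrite /lcomb big_map scaler_sumr; apply: eq_bigr => u _; rewrite scalerA.
Qed.

Lemma inner_lcomb (L : hilbertType R) (phi psi : T -> L) s s' :
  inner (lcomb phi s) (lcomb psi s') =
  kform (fun t t' => inner (phi t) (psi t')) s s'.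
Proof.
rewrite /lcomb /kform; elim: s => [|u s IH].
  by rewrite !big_nil -(scale0r 0) innerZl mul0r.
rewrite !big_cons innerDl IH innerZl; congr (_ + _).
elim: s' {IH} => [|v s' IH'].
  by rewrite !big_nil -(scale0r 0) innerZr rmorph0 mul0r mulr0.
by rewrite !big_cons innerDr innerZr mulrDr IH' -mulrA.
Qed.

Lemma total_familyP (L : hilbertType R) (phi : T -> L) :
  total_family phi <-> closure (lin_span (range phi)) = setT.
Proof.
split=> [phiT|clT x e e0].
  apply/seteqP; split=> // x _ B /nbhs_ballP[e /= e0 eB].
  have [er r0] := gtr0_Re e0; have [s sP] := phiT x _ r0.
  exists (lcomb phi s); split; last first.
    by apply: eB; rewrite -ball_normE /ball_ /= er.
  exists (size s), (fun i => (tnth (in_tuple s) i).1),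
    (fun i => phi (tnth (in_tuple s) i).2).
  by split; [move=> i; eexists|rewrite /lcomb big_tnth].
have : closure (lin_span (range phi)) x by rewrite clT.
have e0' : 0 < e%:C :> R[i] by rewrite ltcR.
move=> /(_ _ (nbhsx_ballx x _ e0'))[y []].
move=> [n [c [v [vP ->]]]]; rewrite -ball_normE /ball_ /= => h.
have vT i : exists t, phi t = v i by have [t _ <-] := vP i; exists t.
have [t tP] := choice vT.
exists [seq (c i, t i) | i <- enum 'I_n].
rewrite /lcomb big_map big_enum /=.
by under eq_bigr do rewrite tP.
Qed.

(** x - y is orthogonal to the combinations, hence to their limit x - y. *)
Lemma total_inner_inj (L : hilbertType R) (phi : T -> L) (x y : L) :
  total_family phi -> (forall t, inner x (phi t) = inner y (phi t)) -> x = y.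
Proof.
move=> phiT xy; apply/eqP; rewrite -subr_eq0 -normr_eq0 -sqrf_eq0 -inner_norm.
set z := x - y; have z0 s : inner z (lcomb phi s) = 0.
  rewrite /lcomb; elim: s => [|u s IH].
    by rewrite big_nil -(scale0r 0) innerZr rmorph0 mul0r.
  by rewrite big_cons innerDr IH innerZr innerBl xy subrr mulr0 addr0.
apply/eqP; apply: (@norm_eps0 _ _ _ (complex.Re `|z|)) => [|e e0].
  by rewrite -ler0c Re_normK.
have [s /ltW se] := phiT z _ e0.
have -> : inner z z = inner z (z - lcomb phi s) by rewrite innerBr z0 subr0.
apply: le_trans (Defs.CauchySchwarz _ _) _.
by rewrite realcM Re_normK ler_wpM2l.
Qed.

(** The adjoints agree by [total_inner_inj]. *)
Lemma total_bop_ext (L1 L2 : hilbertType R) (phi : T -> L1) (S S' : 'B(L1, L2)) :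
  total_family phi -> (forall t, S (phi t) = S' (phi t)) -> S = S'.
Proof.
move=> phiT SS'; have adj y : adjoint S y = adjoint S' y.
  apply: (total_inner_inj phiT) => t.
  by rewrite inner_conj -adjointP SS' adjointP -inner_conj.
apply/bopP => x; apply: inner_inj => y.
by rewrite inner_conj adjointP adj -adjointP -inner_conj.
Qed.

(** S x is the limit of the images of combinations that converge to x. The
    relation G of simultaneous approximation is linear and bounded by M, which
    makes it the graph of a bounded operator. *)
Lemma total_extension (L1 L2 : hilbertType R) (phi1 : T -> L1) (phi2 : T -> L2)
    (M : R) : total_family phi1 -> 0 <= M ->
  (forall s, `|lcomb phi2 s| <= M%:C * `|lcomb phi1 s|) ->
  exists S : 'B(L1, L2), forall t, S (phi1 t) = phi2 t.
Proof.
move=> phiT M0 phiM.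
have M0c : 0 <= M%:C :> R[i] by rewrite ler0c.
pose G x z := forall e : R, 0 < e ->
  exists s, `|x - lcomb phi1 s| < e%:C /\ `|z - lcomb phi2 s| < e%:C.
have Gex x : exists z, G x z.
  have approx n : exists s, `|x - lcomb phi1 s| < (n.+1%:R^-1)%:C.
    by apply: phiT; rewrite invr_gt0.
  have [s sP] := choice approx.
  have [|z zP] := @cauchy_seq_limit _ _ (fun n => lcomb phi2 (s n)).
    move=> e e0; pose d := e / (2 * M + 1).
    have D0 : 0 < 2 * M + 1 by rewrite ltr_wpDl // mulr_ge0.
    have [N NP] := natSinv_lt (divr_gt0 e0 D0); exists N => m n Nm Nn.
    have -> : lcomb phi2 (s m) - lcomb phi2 (s n) =
        lcomb phi2 (s m ++ cscale (-1) (s n)).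
      by rewrite lcomb_cat lcomb_cscale scaleN1r.
    apply: le_lt_trans (phiM _) _; rewrite lcomb_cat lcomb_cscale scaleN1r.
    have -> : lcomb phi1 (s m) - lcomb phi1 (s n) =
        (x - lcomb phi1 (s n)) - (x - lcomb phi1 (s m)).
      by rewrite opprB [RHS]addrC addrA subrK.
    have dn j : (N <= j)%N -> `|x - lcomb phi1 (s j)| <= d%:C.
      by move=> Nj; apply/ltW/(lt_trans (sP j)); rewrite ltcR NP.
    apply: (@le_lt_trans _ _ (M%:C * (d%:C + d%:C))).
      by rewrite ler_wpM2l // (le_trans (ler_normB _ _)) // lerD ?dn.
    rewrite -realcD -realcM ltcR /d.
    have -> : M * (e / (2 * M + 1) + e / (2 * M + 1)) =
      e * (2 * M / (2 * M + 1)).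
      by field; rewrite gt_eqF.
    by rewrite gtr_pMr // ltr_pdivrMr // mul1r ltrDl.
  exists z => e e0; have [N1 N1P] := zP _ e0; have [N2 N2P] := natSinv_lt e0.
  exists (s (N1 + N2)%N); split; last by apply: N1P; rewrite leq_addr.
  by apply: lt_trans (sP _) _; rewrite ltcR N2P // leq_addl.
have Gbound x z : G x z -> `|z| <= M%:C * `|x|.
  move=> Gxz; rewrite -subr_le0 -(Re_normK z) -(Re_normK x) -realcM -rmorphB.
  rewrite lecR; apply: (@le_eps _ _ (M + 1)) => [|e e0].
    by rewrite addr_ge0.
  rewrite lerBlDl -lecR realcD !realcM !Re_normK.
  have [s [/ltW s1 /ltW s2]] := Gxz _ e0.
  rewrite -{1}[z](subrK (lcomb phi2 s)).
  apply: le_trans (ler_normD _ _) _.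
  have h : `|lcomb phi2 s| <= M%:C * (`|x| + e%:C).
    apply: le_trans (phiM s) _; rewrite ler_wpM2l //.
    rewrite -{1}[lcomb phi1 s](subrK x) addrC (le_trans (ler_normD _ _)) //.
    by rewrite lerD // distrC.
  apply: le_trans (lerD s2 h) _.
  by rewrite realcD mulrDl mulrDr mul1r addrCA [e%:C + _]addrC.
have Glin a x z x' z' : G x z -> G x' z' -> G (a *: x + x') (a *: z + z').
  move=> Gx Gx' e e0; have a0 : 0 < complex.Re `|a| + 1.
    by rewrite ltr_wpDl // -ler0c Re_normK.
  have e2 : 0 < e / 2 by rewrite divr_gt0.
  have [s [s1 s2]] := Gx _ (divr_gt0 e2 a0).
  have [s' [s'1 s'2]] := Gx' _ e2.
  have aux (L : hilbertType R) (y y' w w' : L) :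
      `|y - w| < (e / 2 / (complex.Re `|a| + 1))%:C -> `|y' - w'| < (e / 2)%:C ->
      `|a *: y + y' - (a *: w + w')| < e%:C.
    move=> h h'; rewrite opprD addrACA -scalerBr.
    apply: le_lt_trans (ler_normD _ _) _.
    rewrite [X in X%:C]splitr realcD ler_ltD // normrZ.
    apply: (@le_trans _ _ ((complex.Re `|a| + 1)%:C * `|y - w|)).
      by rewrite ler_wpM2r // realcD Re_normK lerDl.
    by rewrite mulrC -ler_pdivlMr ?ltcR // -realcV -realcM ltW.
  exists (cscale a s ++ s'); rewrite !lcomb_cat !lcomb_cscale.
  by split; apply: aux.
have Guniq x z z' : G x z -> G x z' -> z = z'.
  move=> Gz Gz'; apply/eqP; rewrite -subr_eq0 -normr_le0.
  have := Gbound _ _ (Glin (-1) _ _ _ _ Gz' Gz).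
  by rewrite !scaleN1r addNr normr0 mulr0 addrC.
have [S SP] := choice Gex.
have Sb : S \in @bounded_linear R L1 L2.
  apply/asboolP; split; last by exists M => x; exact: Gbound.
  move=> a x y; apply: Guniq (SP _) _; exact: Glin.
exists (BOp Sb) => t; apply: Guniq (SP _) _ => e e0.
by exists [:: (1, t)]; rewrite !lcomb1 !subrr !normr0 ltcR.
Qed.

(** Norms of combinations only depend on the Gram kernel; equality of the Gram
    kernels also says that S^* S fixes the total family. *)
Lemma total_isometry (L1 L2 : hilbertType R) (phi1 : T -> L1) (phi2 : T -> L2) :
  total_family phi1 ->
  (forall t t', inner (phi2 t) (phi2 t') = inner (phi1 t) (phi1 t')) ->
  exists2 S : 'B(L1, L2), Defs.is_isometry S & forall t, S (phi1 t) = phi2 t.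
Proof.
move=> phiT phi12; have [|s|S SP] := @total_extension _ _ phi1 phi2 1 phiT.
- exact: ler01.
- rewrite mul1r -(@ler_pXn2r _ 2) ?nnegrE // -!inner_norm !inner_lcomb.
  by rewrite /kform; under eq_bigr do under eq_bigr do rewrite phi12.
exists S => // x; have SS : adjoint S \b S = bid L1.
  apply: (total_bop_ext phiT) => t; apply: (total_inner_inj phiT) => t' /=.
  by rewrite inner_conj -adjointP !SP phi12 -inner_conj.
apply/eqP; rewrite -(@eqrXn2 _ 2) // -!inner_norm adjointP.
by rewrite -[adjoint S (S x)]/((adjoint S \b S) x) SS.
Qed.

Lemma total_unitary (L1 L2 : hilbertType R) (phi1 : T -> L1) (phi2 : T -> L2) :
  total_family phi1 -> total_family phi2 ->
  (forall t t', inner (phi2 t) (phi2 t') = inner (phi1 t) (phi1 t')) ->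
  exists2 U : 'B(L1, L2), Defs.is_unitary U & forall t, U (phi1 t) = phi2 t.
Proof.
move=> phi1T phi2T phi12; have [U isoU UP] := total_isometry phi1T phi12.
exists U => //; have UU : adjoint U \b U = bid L1.
  by apply/bopP => x; apply: inner_inj => y /=; rewrite -adjointP isometry_inner.
split=> //; apply: (total_bop_ext phi2T) => t /=.
by rewrite -UP -[adjoint U (U _)]/((adjoint U \b U) _) UU.
Qed.

End TotalFamilies.

(** Kolmogorov decomposition. The vector of t is the section of the kernel at t,
    which represents the evaluation at t. *)
Theorem kernel_feature_space (R : realType) (T : Type) (k : pd_kernel R T) :
  exists (L : hilbertType R) (phi : T -> L),
    (forall t t', inner (phi t) (phi t') = k t t') /\ total_family phi.
Proof.
exists (rkhs k), (fun t => rsec k [:: (1, t)]); split=> [t t'|f e e0].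
  have reproducing (f : rkhs k) : inner f (rsec k [:: (1, t')]) = f t'.
    rewrite -[inner _ _]/(rinner _ _) /rinner -(opprK (polar _ ('i *: _))).
    rewrite -polar_il !polar_rsec ev1.
    have -> : ev ('i *: f) [:: (1, t')] = 'i * f t' by rewrite (ev1 ('i *: f)).
    by case: (f t') => x y /=; simpc.
  by rewrite reproducing /= /ksec big_seq1 mul1r.
have [s sP] := rsec_dense f e0; exists s.
suff -> : lcomb (fun t => rsec k [:: (1, t)]) s = rsec k s by rewrite ltcR.
rewrite /lcomb; apply: rkhsP => t; elim: s {sP} => [|u s IH].
  by rewrite big_nil /= /ksec big_nil.
rewrite big_cons /ksec.
have -> : forall (g h : rkhs k), (g + h) t = g t + h t by [].
rewrite IH /= /ksec big_cons; congr (_ + _).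
have -> : forall (a : R[i]) (g : T -> R[i]), (a *: g) t = a * g t by [].
by rewrite big_seq1 mul1r.
Qed.

(** * The kernel attached to a kernel system *)

Section Dilation.
Variables (R : realType) (P : monoidType) (A : cstarAlgType R).
Variables (alpha : P -> A -> A) (H : hilbertType R) (K : P -> A -> P -> 'B(H)).
Hypothesis alphaP : is_action alpha.
Hypotheses (K1 : kernel_unital K) (Kherm : kernel_hermitian alpha K).
Hypotheses (Ktoep : kernel_toeplitz alpha K) (Klin : kernel_linear alpha K).
Hypothesis Kpos : kernel_positive alpha K.
Implicit Types (p q r : P) (a b x y : A) (h : H).

Let gen := (P * A * H)%type.
Implicit Types t : gen.

(** Every generator (p, a, h) stands for the vector pi(a e_p) V(p) h with
    e_p = alpha_p(1): multiplying by e_p lets a range over the whole algebra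
    instead of the right corner at p. *)
Definition cut p a : A := a ** alpha p aone.
Definition cut_gen t : A := cut t.1.1 t.1.2.
Definition lmul_gen b t : gen := (t.1.1, b ** t.1.2, t.2).
Definition shift_gen r t : gen := ((r * t.1.1)%g, alpha r t.1.2, t.2).

Definition gen_kernel t t' : R[i] :=
  inner (K t'.1.1 (star (cut_gen t') ** cut_gen t) t.1.1 t.2) t'.2.

Lemma actionM p a b : alpha p (a ** b) = alpha p a ** alpha p b.
Proof. by have [_ + _] := action_star_hom alphaP p; apply. Qed.

Lemma action_star p a : alpha p (star a) = star (alpha p a).
Proof. by have [_ _ +] := action_star_hom alphaP p; apply. Qed.

Lemma action1_star p : star (alpha p aone) = alpha p aone.
Proof. by rewrite -action_star star1. Qed.

Lemma cutK p a : cut p (cut p a) = cut p a.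
Proof. by rewrite /cut -amulA -actionM amul1. Qed.

Lemma cut_right_corner p a : right_corner alpha p (cut p a).
Proof. by exists a. Qed.

Lemma right_corner_cut p a : right_corner alpha p a -> cut p a = a.
Proof. by case=> b _ <-; exact: cutK. Qed.

Lemma cut_unit a : cut 1%g a = a.
Proof. by rewrite /cut (action_id alphaP) mul1a. Qed.

Lemma cut_amul p a b : cut p (b ** a) = b ** cut p a.
Proof. by rewrite /cut amulA. Qed.

Lemma cut_lin p a b (c : R[i]) : cut p (a + c *: b) = cut p a + c *: cut p b.
Proof. by rewrite /cut amulDl amulZl. Qed.

Lemma cut_action r p a : cut (r * p)%g (alpha r a) = alpha r (cut p a).
Proof. by rewrite /cut actionM (action_comp alphaP). Qed.

Lemma corner_cut p q a b : corner alpha p q (star (cut p a) ** cut q b).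
Proof.
by exists (star a ** b) => //; rewrite /cut starM action1_star !amulA.
Qed.

Lemma gen_kernel_herm t t' : gen_kernel t t' = (gen_kernel t' t)^*.
Proof.
rewrite /gen_kernel -inner_conj adjointP Kherm; last exact: corner_cut.
by rewrite starM starK.
Qed.

(** The coefficients of the combination are absorbed into the vectors of H. *)
Lemma gen_kernel_pos (s : seq (R[i] * gen)) : 0 <= kform gen_kernel s s.
Proof.
have := @Kpos (size s) (fun i => (tnth (in_tuple s) i).2.1.1)
  (fun i => cut_gen (tnth (in_tuple s) i).2) _
  (fun i => (tnth (in_tuple s) i).1 *: (tnth (in_tuple s) i).2.2).
move=> /(_ (fun i => cut_right_corner _ _)); congr (_ <= _).
rewrite /kform exchange_big /= [RHS]big_tnth; apply: eq_bigr => i _.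
rewrite [RHS]big_tnth.
have inner_suml n (F : 'I_n -> H) z : inner (\sum_j F j) z = \sum_j inner (F j) z.
  elim/big_rec2: _ => [|j c x _ <-]; last by rewrite innerDl.
  by rewrite -(scale0r 0) innerZl mul0r.
rewrite inner_suml; apply: eq_bigr => j _.
by rewrite linearZ innerZl innerZr mulrA.
Qed.

Definition dilation_kernel : pd_kernel R gen :=
  PDKernel gen_kernel_herm gen_kernel_pos.

(** Left multiplication by b and by b^* are formal adjoints: both sides contain
    (a' e_p')^* b a e_p. *)
Lemma gen_kernel_lmul b t t' :
  gen_kernel (lmul_gen b t) t' = gen_kernel t (lmul_gen (star b) t').
Proof.
by rewrite /gen_kernel /cut_gen /= !cut_amul starM starK amulA.
Qed.

(** This is the Toeplitz condition, because the shift acts on a e_p by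
    alpha_r. *)
Lemma gen_kernel_shift r t t' :
  gen_kernel (shift_gen r t) (shift_gen r t') = gen_kernel t t'.
Proof.
rewrite /gen_kernel /cut_gen /= !cut_action -action_star -actionM -Ktoep //.
exact: corner_cut.
Qed.

Lemma gen_kernel_lin p a b (c : R[i]) h t' :
  gen_kernel (p, a + c *: b, h) t' =
  gen_kernel (p, a, h) t' + c * gen_kernel (p, b, h) t'.
Proof.
rewrite /gen_kernel /cut_gen /= cut_lin amulDr amulZr -Klin;
  try exact: corner_cut.
by rewrite bopD bopZ innerDl innerZl.
Qed.

Lemma gen_kernel_linr p a h h' (c : R[i]) t' :
  gen_kernel (p, a, c *: h + h') t' =
  c * gen_kernel (p, a, h) t' + gen_kernel (p, a, h') t'.
Proof. by rewrite /gen_kernel /cut_gen /= linearP innerDl innerZl. Qed.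

Lemma gen_kernel_cut p a h t' :
  gen_kernel (p, cut p a, h) t' = gen_kernel (p, a, h) t'.
Proof. by rewrite /gen_kernel /cut_gen /= cutK. Qed.

(** * Existence of the minimal dilation *)

Section Existence.
Variables (L : hilbertType R) (phi : gen -> L).
Hypothesis phiE : forall t t', inner (phi t) (phi t') = gen_kernel t t'.
Hypothesis phiT : total_family phi.

Lemma phi_lin p a b (c : R[i]) h :
  phi (p, a + c *: b, h) = phi (p, a, h) + c *: phi (p, b, h).
Proof.
apply: (total_inner_inj phiT) => t.
by rewrite innerDl innerZl !phiE gen_kernel_lin.
Qed.

Lemma phi_linr p a h h' (c : R[i]) :
  phi (p, a, c *: h + h') = c *: phi (p, a, h) + phi (p, a, h').
Proof.
apply: (total_inner_inj phiT) => t.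
by rewrite innerDl innerZl !phiE gen_kernel_linr.
Qed.

Lemma phi_cut p a h : phi (p, cut p a, h) = phi (p, a, h).
Proof.
by apply: (total_inner_inj phiT) => t; rewrite !phiE gen_kernel_cut.
Qed.

Lemma phi_lmul_adj b t t' :
  inner (phi (lmul_gen b t)) (phi t') =
  inner (phi t) (phi (lmul_gen (star b) t')).
Proof. by rewrite !phiE gen_kernel_lmul. Qed.

Let lmul_comb b := lcomb (fun t => phi (lmul_gen b t)).

Let lmul_comb1 s : lmul_comb aone s = lcomb phi s.
Proof.
apply: eq_bigr => u _; congr (_ *: phi _).
by case: u.2 => [[p a] h]; rewrite /lmul_gen /= amul1.
Qed.

Let lmul_comb_inner b x s :
  inner (lmul_comb b s) (lmul_comb x s) =
  inner (lmul_comb (star x ** b) s) (lmul_comb aone s).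
Proof.
rewrite lmul_comb1 /lmul_comb !inner_lcomb.
apply: eq_bigr => u _; apply: eq_bigr => v _.
congr (_ * _).
have -> : lmul_gen (star x ** b) u.2 = lmul_gen (star x) (lmul_gen b u.2).
  by rewrite /lmul_gen /= amulA.
by rewrite [RHS]phi_lmul_adj starK.
Qed.

Let lmul_comb_lin b x c s :
  lmul_comb (b + c *: x) s = lmul_comb b s + c *: lmul_comb x s.
Proof.
rewrite /lmul_comb /lcomb scaler_sumr -big_split; apply: eq_bigr => u _ /=.
rewrite /lmul_gen amulDl amulZl phi_lin scalerDr; congr (_ + _).
by rewrite !scalerA mulrC.
Qed.

(** Let M = |b| + 1 and y = y^* with y^2 = 1 - b^* b / M^2. By [lmul_comb_inner],
    0 <= |pi(y) s|^2 = |s|^2 - |pi(b) s|^2 / M^2. *)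
Let lmul_comb_bound b s :
  `|lmul_comb b s| <= (complex.Re `|b| + 1)%:C * `|lcomb phi s|.
Proof.
set M := _ + 1; have M0 : 0 < M by rewrite ltr_wpDl // -ler0c Re_normK.
have M0c : 0 < M%:C :> R[i] by rewrite ltcR.
have bM : `|b| < M%:C by rewrite -Re_normK ltcR ltrDl.
pose x := (M%:C ^- 2) *: (star b ** b).
have [||y [yy y2]] := @sqrt_one_sub _ _ x.
- by rewrite starZ starM starK fmorphV rmorphXn /= (CrealP _) // gtr0_real.
- rewrite normrZ cstar_norm gtr0_norm ?invr_gt0 ?exprn_gt0 //.
  by rewrite ltr_pdivrMl ?exprn_gt0 // mulr1 ltrXn2r.
have : 0 <= inner (lmul_comb y s) (lmul_comb y s) by rewrite inner_norm exprn_ge0.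
rewrite lmul_comb_inner yy y2 -scaleN1r lmul_comb_lin /x innerDl innerZl mulN1r.
have -> : lmul_comb (M%:C ^- 2 *: (star b ** b)) s =
    M%:C ^- 2 *: lmul_comb (star b ** b) s.
  have := lmul_comb_lin 0 (star b ** b) (M%:C ^- 2) s; rewrite add0r => ->.
  suff -> : lmul_comb 0 s = 0 by rewrite add0r.
  have /eqP := lmul_comb_lin 0 0 1 s.
  by rewrite !scale1r addr0 -subr_eq subrr eq_sym => /eqP.
rewrite innerZl -lmul_comb_inner !inner_norm lmul_comb1 subr_ge0.
rewrite ler_pdivrMl ?exprn_gt0 // -exprMn ler_pXn2r // nnegrE //.
by rewrite mulr_ge0 // ltW.
Qed.

Lemma left_mul_op b : exists S : 'B(L), forall t, S (phi t) = phi (lmul_gen b t).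
Proof.
apply: (total_extension phiT) (lmul_comb_bound b).
by rewrite addr_ge0 // -ler0c Re_normK.
Qed.

Lemma shift_op r : exists2 S : 'B(L), Defs.is_isometry S &
  forall t, S (phi t) = phi (shift_gen r t).
Proof.
by apply: (total_isometry phiT) => t t'; rewrite !phiE gen_kernel_shift.
Qed.

(** Unitality of K makes h |-> (1, 1, h) isometric. *)
Lemma unit_embedding : exists2 J : 'B(H, L), Defs.is_isometry J &
  forall h, J h = phi (1%g, aone, h).
Proof.
have Jn h : `|phi (1%g, aone, h)| = `|h|.
  apply/eqP; rewrite -(@eqrXn2 _ 2) // -!inner_norm phiE /gen_kernel /cut_gen /=.
  by rewrite cut_unit star1 amul1 K1.
have Jb : (fun h => phi (1%g, aone, h)) \in @bounded_linear R H L.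
  apply/asboolP; split; first by move=> c h h'; rewrite phi_linr.
  by exists 1 => h; rewrite mul1r Jn.
by exists (BOp Jb).
Qed.

Lemma feature_dilation :
  exists (J : 'B(H, L)) (V : P -> 'B(L)) (pi : A -> 'B(L)),
  is_dilation alpha K J V pi /\ is_minimal alpha J V pi.
Proof.
have [J isoJ JE] := unit_embedding.
have [pi piE] := choice left_mul_op.
have Vex r : exists S : 'B(L), Defs.is_isometry S /\
    forall t, S (phi t) = phi (shift_gen r t).
  by have [S] := shift_op r; exists S.
have [V VP] := choice Vex.
have isoV r : Defs.is_isometry (V r) by have [] := VP r.
have VE r t : V r (phi t) = phi (shift_gen r t) by have [_ ->] := VP r.
have piVJ a p h : pi a (V p (J h)) = phi (p, cut p a, h).
  by rewrite JE VE piE /lmul_gen /shift_gen /= mulg1.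
have ext := total_bop_ext phiT.
exists J, V, pi; split.
  split=> //.
  - split=> //.
      by apply: ext => -[[p a] h]; rewrite VE /shift_gen /= mul1g (action_id alphaP).
    move=> p q; apply: ext => -[[r a] h] /=.
    by rewrite !VE /shift_gen /= mulgA (action_comp alphaP).
  - split.
    + move=> c a b; apply: ext => -[[p x] h].
      rewrite bopD bopZ !piE /lmul_gen /= amulDl amulZl addrC phi_lin addrC //.
    + by move=> a b; apply: ext => -[[p x] h] /=; rewrite !piE /lmul_gen /= amulA.
    + move=> a; apply: adjoint_unique => x y.
      have -> : pi a = adjoint (pi (star a)).
        apply: ext => t; apply: (total_inner_inj phiT) => t'.
        by rewrite piE phi_lmul_adj inner_adjointl piE.
      by rewrite inner_adjointl.
  - move=> p a; apply: ext => -[[q x] h] /=.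
    by rewrite VE !piE VE /lmul_gen /shift_gen /= actionM.
  - move=> p a q pq; apply/bopP => h; apply: inner_inj => h' /=.
    rewrite inner_conj [RHS]inner_conj !inner_adjointl; congr (_^*).
    have [x _ ax] := pq.
    have aq : cut q a = a by rewrite -ax -[_ ** alpha q aone]/(cut q _) cutK.
    have pa : cut p (alpha p aone) = alpha p aone by rewrite /cut -actionM amul1.
    rewrite piVJ JE VE phiE /gen_kernel /cut_gen /shift_gen /= mulg1 cutK aq pa.
    by rewrite action1_star -ax !amulA -actionM amul1.
rewrite /is_minimal; set S := (X in lin_span X).
have -> : S = range phi.
  apply/seteqP; split=> [_ [p [a [h [_ ->]]]]|_ [[[p a] h] _ <-]].
    by rewrite piVJ; eexists.
  exists p, (cut p a), h; split; first exact: cut_right_corner.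
  by rewrite piVJ cutK phi_cut.
exact/total_familyP.
Qed.

End Existence.

(** * The generators of a minimal dilation *)

Section Uniqueness.
Variables (L : hilbertType R) (J : 'B(H, L)) (V : P -> 'B(L)) (pi : A -> 'B(L)).
Hypothesis dil : is_dilation alpha K J V pi.
Hypothesis min : is_minimal alpha J V pi.

Definition feature t : L := pi (cut_gen t) (V t.1.1 (J t.2)).

Lemma feature_inner t t' : inner (feature t) (feature t') = gen_kernel t t'.
Proof.
have [_ piM pi_star] := dilation_hom dil.
rewrite /gen_kernel (dilation_eq dil); last exact: corner_cut.
rewrite /feature piM pi_star /=.
rewrite -[star (pi _)]/(adjoint _).
by rewrite !inner_adjointl.
Qed.

Lemma feature_total : total_family feature.
Proof.
apply/total_familyP; rewrite -[RHS]min; congr (closure (lin_span _)).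
apply/seteqP; split=> [_ [[[p a] h] _ <-]|_ [p [a [h [pa ->]]]]].
  by exists p, (cut p a), h; split; first exact: cut_right_corner.
by exists (p, a, h) => //; rewrite /feature /cut_gen /= right_corner_cut.
Qed.

Lemma feature_lmul b t : pi b (feature t) = feature (lmul_gen b t).
Proof.
have [_ piM _] := dilation_hom dil.
by rewrite /feature /cut_gen /= cut_amul piM.
Qed.

Lemma feature_shift r t : V r (feature t) = feature (shift_gen r t).
Proof.
have [_ VM _] := dilation_rep dil.
have cov a (x : L) : V r (pi a x) = pi (alpha r a) (V r x).
  by have /bopP := dilation_cov dil r a; apply.
by rewrite /feature /cut_gen /= cut_action cov VM.
Qed.

(** Minimality forces pi(1) = 1: pi(1) fixes the total family of generators. *)
Lemma feature_unit h : J h = feature (1%g, aone, h).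
Proof.
have [V1 _ _] := dilation_rep dil.
have pi1 : pi aone = bid L.
  apply: (total_bop_ext feature_total) => -[[p a] h'].
  by rewrite feature_lmul /lmul_gen /= amul1.
by rewrite /feature /cut_gen /= cut_unit pi1 V1.
Qed.

End Uniqueness.

End Dilation.

Theorem theorem4p9 (R : realType) (P : monoidType) (A : cstarAlgType R)
    (alpha : P -> A -> A) (H : hilbertType R) (K : P -> A -> P -> 'B(H)) :
  left_cancellative P -> is_action alpha ->
  kernel_unital K -> kernel_hermitian alpha K -> kernel_toeplitz alpha K ->
  kernel_linear alpha K -> kernel_positive alpha K ->
  (exists (L : hilbertType R) (J : 'B(H, L)) (V : P -> 'B(L))
      (pi : A -> 'B(L)),
    is_dilation alpha K J V pi /\ is_minimal alpha J V pi) /\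
  (forall (L1 : hilbertType R) (J1 : 'B(H, L1)) (V1 : P -> 'B(L1))
      (pi1 : A -> 'B(L1))
      (L2 : hilbertType R) (J2 : 'B(H, L2)) (V2 : P -> 'B(L2))
      (pi2 : A -> 'B(L2)),
    is_dilation alpha K J1 V1 pi1 -> is_minimal alpha J1 V1 pi1 ->
    is_dilation alpha K J2 V2 pi2 -> is_minimal alpha J2 V2 pi2 ->
    unitarily_equivalent J1 V1 pi1 J2 V2 pi2).
Proof.
move=> _ alphaP K1 Kherm Ktoep Klin Kpos; split.
  have [L [phi [phiE phiT]]] :=
    kernel_feature_space (dilation_kernel alphaP Kherm Kpos).
  by exists L; apply: (feature_dilation alphaP K1 Ktoep Klin phiE phiT).
move=> L1 J1 V1 pi1 L2 J2 V2 pi2 dil1 min1 dil2 min2.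
pose phi1 := feature alpha J1 V1 pi1; pose phi2 := feature alpha J2 V2 pi2.
have phi1T : total_family phi1 := feature_total alphaP min1.
have phi2T : total_family phi2 := feature_total alphaP min2.
have [t t'|U unitU UE] := total_unitary phi1T phi2T.
  by rewrite !(feature_inner alphaP dil1, feature_inner alphaP dil2).
exists U; split=> //.
- apply/bopP => h /=.
  by rewrite (feature_unit alphaP dil1 min1) (feature_unit alphaP dil2 min2) UE.
- move=> a; apply: (total_bop_ext phi1T) => t /=.
  by rewrite UE (feature_lmul dil1) (feature_lmul dil2) UE.
- move=> p; apply: (total_bop_ext phi1T) => t /=.
  by rewrite UE (feature_shift alphaP dil1) (feature_shift alphaP dil2) UE.
Qed.
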